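(* Let $r>1$ be an integer. There exists a constant $A_r>0$ depending only on $r$ such that for every $\beta>0$ there exists $C>0$ such that for $p=p(n)\ge\frac Cn$, with high probability $G(n,p)\to_r\mathcal C$, where $\mathcal C=\{C_t\mid A_r\log n\le t\le(\lambda^*_o-\beta)n,\ t\text{ is odd}\}$ and $\lambda^*_o=\lambda^*_o(r)$. In particular, with high probability $G(n,p)\to_rC_{\lfloor(\lambda^*_o-\beta)n\rfloor_{odd}}$.
   Context: $G(n,p)$ is the binomial random graph on $\{1,\dots,n\}$ with each pair an edge independently with probability $p$. ''With high probability'' means with probability tending to $1$ as $n\to\infty$. $C_t$ is the cycle of length $t$ (with $t$ edges); $\log$ is the natural logarithm. $\lfloor\ell\rfloor_{odd}$ is the largest odd integer $m\le\ell$. For graphs $G,H$, $G\to_rH$ means that every $r$-coloring of the edges of $G$ contains a monochromatic copy of $H$. For a family $\mathcal H$ of graphs, $G\to_r\mathcal H$ means that for every $r$-coloring of the edges of $G$ there exists a color $i$ such that there is a monochromatic copy of every $H\in\mathcal H$ in color $i$. $\lambda^*_o=\lambda^*_o(r)$ is the supremum, over all $\varepsilon>0$, of the numbers $\lambda$ for which there exists $k_0$ such that for all $k\ge k_0$ every graph $G$ on $k$ vertices with at least $(1-\varepsilon)\binom k2$ edges satisfies $G\to_rC_{\lfloor\lambda k\rfloor_{odd}}$. The number $\beta$ in the ''in particular'' part is understood to be small enough that the cycle length is meaningful ($\beta<\lambda^*_o$). *)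

(* Defs.v *)
From HB Require Import structures.
From mathcomp Require Import all_boot all_order all_algebra.
From mathcomp Require Import all_classical all_reals all_analysis.

Set Implicit Arguments.
Unset Strict Implicit.
Unset Printing Implicit Defensive.

Import Order.TTheory GRing.Theory Num.Theory numFieldNormedType.Exports.
Local Open Scope classical_set_scope.
Local Open Scope ring_scope.

Section Graphs.

Definition pairs (T : finType) : {set {set T}} := [set e : {set T} | #|e| == 2%N]%SET.

Definition sgraph (T : finType) := {E : {set {set T}} | E \subset pairs T}.

Definition edges (T : finType) (G : sgraph T) : {set {set T}} := val G.

(* The condition [ordS i != i] only matters for [t = 1], where it removes the
   loop; for [t >= 3] this is the usual cycle with [t] edges. *)
Definition cycle_edges (t : nat) : {set {set 'I_t}} :=
  [set [set i; ordS i]%SET | i : 'I_t & ordS i != i]%SET.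

Lemma cycle_edges_sub (t : nat) : cycle_edges t \subset pairs 'I_t.
Proof.
apply/fintype.subsetP => e /imsetP[i]; rewrite inE => ni ->.
by rewrite inE cards2 eqSS eqb1 eq_sym.
Qed.

Definition cycle_graph (t : nat) : sgraph 'I_t :=
  exist _ (cycle_edges t) (cycle_edges_sub t).

(* Edge colorings are total functions on vertex sets; only the values on the
   edges of [G] are ever used. *)
Definition mono_copy (r : nat) (T U : finType) (G : sgraph T)
    (c : {set T} -> 'I_r) (i : 'I_r) (H : sgraph U) : Prop :=
  exists f : U -> T, injective f /\
    forall e : {set U}, e \in edges H ->
      f @: e \in edges G /\ c (f @: e) = i.

Definition arrows (r : nat) (T U : finType) (G : sgraph T) (H : sgraph U) : Prop :=
  forall c : {set T} -> 'I_r, exists i : 'I_r, mono_copy G c i H.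

(* The family is [{H t | t in D}]; one color has to serve all its members. *)
Definition arrows_family (r : nat) (T : finType) (G : sgraph T)
    (I : Type) (V : I -> finType) (D : set I) (H : forall t : I, sgraph (V t)) : Prop :=
  forall c : {set T} -> 'I_r, exists i : 'I_r,
    forall t : I, D t -> mono_copy G c i (H t).

End Graphs.

Section OddFloor.
Variable R : realType.

(* Takes the value 0 when [l < 1], where no odd natural number is [<= l]. *)
Definition oddfloor (l : R) : nat :=
  let m := Num.truncn l in if odd m then m else m.-1.

Lemma oddfloorP (l : R) : 1 <= l ->
  [/\ odd (oddfloor l), (oddfloor l)%:R <= l &
      forall m : nat, odd m -> m%:R <= l -> (m <= oddfloor l)%N].
Proof.
move=> l1; have l0 : 0 <= l by exact: le_trans l1.
have t1 : (0 < Num.truncn l)%N by rewrite truncn_ge_nat.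
have tl : (Num.truncn l)%:R <= l by rewrite truncn_le.
rewrite /oddfloor; case: ifP => ot.
  by split=> // m _ ml; rewrite truncn_ge_nat.
split.
- by case: (Num.truncn l) t1 ot => //= k _ /negbFE.
- by apply: le_trans tl; rewrite ler_nat leq_pred.
- move=> m om ml; have : (m <= Num.truncn l)%N by rewrite truncn_ge_nat.
  rewrite leq_eqVlt => /orP[/eqP e|]; first by rewrite -e om in ot.
  by case: (Num.truncn l) t1 => // k _; rewrite ltnS.
Qed.

End OddFloor.

Section RandomGraph.
Variable R : realType.

Definition gnp_weight (n : nat) (p : R) (G : sgraph 'I_n) : R :=
  \prod_(e in pairs 'I_n) (if e \in edges G then p else 1 - p).

Definition gnp_prob (n : nat) (p : R) (Q : sgraph 'I_n -> Prop) : R :=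
  \sum_(G : sgraph 'I_n | `[< Q G >]) gnp_weight p G.

Definition gnp_whp (p : nat -> R) (Q : forall n : nat, sgraph 'I_n -> Prop) : Prop :=
  gnp_prob (p n) (Q n) @[n --> \oo] --> (1 : R).

End RandomGraph.

Section LambdaOdd.
Variable R : realType.

(* Only positive [l] are considered: otherwise the cycle length is
   meaningless. *)
Definition lambda_odd_set (r : nat) : set R :=
  [set l : R | 0 < l /\
    exists eps : R, 0 < eps /\
    exists k0 : nat, forall k : nat, (k0 <= k)%N ->
      forall G : sgraph 'I_k,
        (1 - eps) * ('C(k, 2))%:R <= (#|edges G|)%:R ->
        arrows r G (cycle_graph (oddfloor (l * k%:R)))].

Definition lambda_odd (r : nat) : R := sup (lambda_odd_set r).

End LambdaOdd.

(* Main.v *)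
(* A pair of vertex sets is [h]-joined in a color if any two subsets of size
   [h] span an edge of that color. The only property of the random graph that is
   used is that any two disjoint sets of linear size span an edge; a union bound
   over all pairs of sets gives it for p >= C / n.

   Regularity without densities. Given an edge coloring, count over all colors
   the pairs of vertices whose classes in a partition span no edge of that color.
   This count is at most r n^2 and does not decrease under refinement. If many
   pairs of classes are joined in no color, then each such pair spans an edge of
   some color, and splitting by a hole of that color raises the count by a
   constant fraction of n^2. Hence after boundedly many steps the vertices are,
   up to a small remainder, split into k classes of equal size, with almost all
   pairs joined in some color. Coloring the reduced graph accordingly, the
   definition of lambda* gives a monochromatic odd cycle of length about
   lambda* k through the classes.

   Cycles of every odd length. In the blow-up of an odd cycle with joined pairs,
   delete a maximal non-expanding set from two adjacent classes; from any vertex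
   left, two disjoint binary trees of the same depth O(log n) grow until their
   last levels are of linear size. Depth-first search along a prescribed walk in
   the cycle finds a path that follows the walk and visits almost everything, as
   a vertex where the search gets stuck has no neighbor among the unused vertices
   of the next class, and there are fewer than h of these. A zigzag walk between
   the last levels of the two trees closes a cycle of any prescribed odd length. *)
Require Import Defs.
From mathcomp Require Import all_boot all_order all_algebra.
From mathcomp Require Import all_classical all_reals all_analysis.
From mathcomp Require Import zify ring lra.
Import Order.TTheory GRing.Theory Num.Theory numFieldNormedType.Exports.
Local Open Scope classical_set_scope.
Local Open Scope ring_scope.

Section Combinatorics.
Set Implicit Arguments.
Unset Strict Implicit.
Unset Printing Implicit Defensive.
Local Open Scope bool_scope.
Local Open Scope nat_scope.
Local Open Scope set_scope.

Definition joined (T : finType) (E : rel T) (h : nat) (X Y : {set T}) : Prop :=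
  forall X' Y' : {set T}, X' \subset X -> Y' \subset Y ->
    h <= #|X'| -> h <= #|Y'| -> exists x y, [/\ x \in X', y \in Y' & E x y].

(** * Depth-first search along a walk *)

Section WalkEmbedding.
Variables (T : finType) (E : rel T) (I : eqType).
Variables (w : nat -> I) (V : I -> {set T}) (n1 n2 : I -> I) (L h : nat).

(* The path is stored in reverse: the head of [rp] is its current endpoint. *)
Fixpoint follows (rp : seq T) : bool :=
  if rp is v :: rp' then
    [&& v \in V (w (size rp')), (if rp' is u :: _ then E u v else true)
      & follows rp']
  else true.

Hypothesis disV : forall a b x, x \in V a -> x \in V b -> a = b.
Hypothesis succw : forall p, p < L -> w p.+1 = n1 (w p) \/ w p.+1 = n2 (w p).
Hypothesis joinw : forall p, p < L -> joined E h (V (w p)) (V (w p.+1)).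
Hypothesis cardV : forall p, p <= L ->
  count (fun q => w q == w p) (iota 0 L.+1) + 3 * h + 1 <= #|V (w p)|.

Lemma follows_count rp a : follows rp ->
  count (mem (V a)) rp <= count (fun q => w q == a) (iota 0 (size rp)).
Proof.
elim: rp => [|v rp IH] //; rewrite [follows _]/= => /and3P[vV _ /IH le_rp].
rewrite [size _]/= -(addn1 (size rp)) iotaD count_cat add0n /= addn0 addnC.
rewrite leq_add //; case va: (v \in V a) => //=.
by rewrite (disV vV va) eqxx.
Qed.

Definition free (D : {set T}) (rp : seq T) (b : I) := [set u in V b | (u \notin D) && (u \notin rp)].

(** The search discards into [D] the vertices where it got stuck. The step [p] is not recorded, so
    the property survives as the free sets shrink. *)
Definition dead (D : {set T}) (rp : seq T) (v : T) : bool :=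
  [exists p : 'I_L, (v \in V (w p)) && [forall u in free D rp (w p.+1), ~~ E v u]].

(** A path following the walk takes no more vertices from a class than the walk visits, so the slack
    [3 * h + 1] of [cardV] is left for free and discarded vertices. *)
Lemma card_free (D : {set T}) rp p : p <= L -> follows rp -> size rp <= L.+1 ->
  3 * h < #|free D rp (w p)| + #|D :&: V (w p)|.
Proof.
move=> pL frp srp; have := cardV pL.
have : #|V (w p)| <= #|free D rp (w p)| + #|D :&: V (w p)|
    + #|[seq u <- rp | u \in V (w p)]|.
  apply: leq_trans (_ : _ <= #|(free D rp (w p) :|: D :&: V (w p))
     :|: [set u in [seq u <- rp | u \in V (w p)]]|) _.
    apply/subset_leq_card/fintype.subsetP => u uV.
    by rewrite !inE mem_filter uV /=; case: (u \in D); case: (u \in rp).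
  rewrite (leq_trans (leq_card_setU _ _)) // leq_add //.
    exact: leq_card_setU.
  by rewrite cardsE.
have := card_size [seq u <- rp | u \in V (w p)]; rewrite size_filter.
have := follows_count (w p) frp.
have : count (fun q => w q == w p) (iota 0 (size rp)) <=
       count (fun q => w q == w p) (iota 0 L.+1).
  by rewrite -(subnKC srp) iotaD count_cat leq_addr.
rewrite -[count (mem _) rp]/(count (fun u => u \in V (w p)) rp); lia.
Qed.

(** A class has at most two successors on the walk, [n1 a] and [n2 a]. Toward each, the dead
    vertices see none of at least [h] free ones, so joinedness caps them at [h]. Improving
    [2 * h + 1] to [2 * h] lets [D] grow one vertex at a time. *)
Lemma card_dead (D : {set T}) rp a : follows rp -> size rp <= L.+1 ->
  (forall v, v \in D -> dead D rp v) ->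
  (forall b, #|D :&: V b| <= 2 * h + 1) -> #|D :&: V a| <= 2 * h.
Proof.
move=> frp srp dD cD.
pose X b := [set v in D :&: V a | [exists p : 'I_L, [&& w p == a, w p.+1 == b
  & [forall u in free D rp b, ~~ E v u]]]].
have cX b : #|X b| <= h.
  rewrite leqNgt; apply/negP => hX.
  have /card_gt0P[v0] : 0 < #|X b| by exact: leq_ltn_trans hX.
  rewrite inE => /andP[_ /existsP[p /and3P[/eqP wa /eqP wb _]]].
  have [|||v [u [vX uf Evu]]] := joinw (ltn_ord p) (X' := X b) (Y' := free D rp b) _ _ (ltnW hX).
  - by rewrite wa; apply/fintype.subsetP => v; rewrite !inE => /andP[/andP[_ ->]].
  - by rewrite wb; apply/fintype.subsetP => v; rewrite !inE => /andP[].
  - by have := card_free D (ltn_ord p) frp srp; have := cD b; rewrite wb; lia.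
  move: vX; rewrite inE => /andP[_ /existsP[q /and3P[_ _ /forall_inP/(_ u uf)]]].
  by rewrite Evu.
have sub : D :&: V a \subset X (n1 a) :|: X (n2 a).
  apply/fintype.subsetP => v; rewrite inE => /andP[vD va].
  have /existsP[p /andP[vp bp]] := dD v vD.
  have ap : w p = a := disV vp va.
  have [e|e] := succw (ltn_ord p); rewrite e ap in bp; rewrite 4!inE vD va /=;
    apply/orP; [left|right; rewrite !inE vD va]; apply/existsP; exists p;
    by rewrite e ap !eqxx.
rewrite (leq_trans (subset_leq_card sub)) // (leq_trans (leq_card_setU _ _)) //.
by rewrite mul2n -addnn leq_add.
Qed.

Lemma sub_dead (D D' : {set T}) rp rp' v :
  (forall u, u \in D \/ u \in rp -> u \in D' \/ u \in rp') ->
  dead D rp v -> dead D' rp' v.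
Proof.
move=> sub /existsP[p /andP[vp /forall_inP dp]]; apply/existsP; exists p.
rewrite vp; apply/forall_inP => u; rewrite inE => /and3P[uV uD' urp'].
apply: dp; rewrite inE uV -negb_or; apply/negP => /orP/sub [].
  by apply/negP.
by apply/negP.
Qed.

(** [k] is fuel: extending the path raises [size rp + 2 * #|D|] by one, and so does moving the head
    to [D]; this potential never exceeds [3 * #|T|]. *)
Lemma walk_search k (D : {set T}) rp :
  3 * #|T| < k + size rp + 2 * #|D| ->
  follows rp -> uniq rp -> size rp <= L.+1 -> all (fun v => v \notin D) rp ->
  (forall v, v \in D -> dead D rp v) -> (forall b, #|D :&: V b| <= 2 * h) ->
  exists rp', [/\ size rp' = L.+1, uniq rp' & follows rp'].
Proof.
elim: k D rp => [|k IH] D rp lt_T frp urp srp dis dD cD.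
  have cDT : #|D| <= #|T| by exact: max_card.
  have : size rp <= #|T| by rewrite -(card_uniqP urp); exact: max_card.
  lia.
move: srp; rewrite leq_eqVlt => /predU1P[|srp]; first by exists rp.
have cD1 b : #|D :&: V b| <= 2 * h + 1 by rewrite (leq_trans (cD b)) ?leq_addr.
have push u : u \in free D rp (w (size rp)) ->
    (if rp is v :: _ then E v u else true) ->
    exists rp', [/\ size rp' = L.+1, uniq rp' & follows rp'].
  rewrite inE => /and3P[uV uD urp0] Eu; apply: (IH D (u :: rp)) => //=.
  - by rewrite addnS -addSn.
  - by rewrite uV Eu.
  - by rewrite urp0.
  - by rewrite uD.
  - move=> v /dD; apply: sub_dead => x []; first by left.
    by move=> xrp; right; rewrite inE xrp orbT.
case: rp lt_T frp urp srp dis dD push => [|v rp] lt_T frp urp srp dis dD push.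
  have /card_gt0P[u uf] : 0 < #|free D [::] (w 0)|.
    by have := card_free D (leq0n L) frp (ltnW srp); have := cD (w 0); lia.
  exact: push uf _.
case: (pickP [pred u in free D (v :: rp) (w (size (v :: rp))) | E v u]) => [u|nu].
  by case/andP; apply: push.
move: dis => /= /andP[vD dis]; move: frp urp => /= /and3P[vV _ frp] /andP[vrp urp].
(* Moving [v] from the path to [D] does not change which vertices are free, so [v] is dead and the
   others stay dead. *)
have dD' x : x \in v |: D -> dead (v |: D) rp x.
  case/setU1P => [->|/dD].
    apply/existsP; exists (Ordinal (srp : size rp < L)); rewrite vV; apply/forall_inP => u uf.
    apply/negP => Evu; have /negP[] := negbT (nu u); rewrite inE Evu andbT.
    by move: uf; rewrite !inE !negb_or andbA -andbA => /and3P[-> /andP[-> ->] ->].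
  apply: sub_dead => u []; rewrite !inE; first by move=> ->; left; rewrite orbT.
  by case/orP => ->; [left|right].
apply: (IH (v |: D) rp) => //.
- by rewrite cardsU1 vD; move: lt_T => /=; lia.
- exact: leq_trans (ltnW srp).
- apply/allP => u urp'; rewrite !inE negb_or (allP dis) // andbT.
  by apply: contraNneq vrp => <-.
- move=> b; apply: (card_dead (rp := rp)) => // [|{}b]; first exact: leq_trans (ltnW srp).
  rewrite finset.setIUl (leq_trans (leq_card_setU _ _)) // addnC leq_add //.
  by rewrite (leq_trans (subset_leq_card (finset.subsetIl _ _))) ?cards1.
Qed.

Lemma walk_embedding :
  exists rp, [/\ size rp = L.+1, uniq rp & follows rp].
Proof.
apply: (walk_search (k := (3 * #|T|).+1) (D := finset.set0) (rp := [::])) => // [|v|b].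
- by rewrite cards0; lia.
- by rewrite inE.
- by rewrite finset.set0I cards0.
Qed.

Lemma follows_sorted rp : symmetric E -> follows rp -> sorted E rp.
Proof.
move=> symE; elim: rp => [|v [|u rp] IH] //= /and3P[_ Euv frp].
by rewrite symE Euv /=; apply: IH.
Qed.

Lemma follows_nth x0 rp i : follows rp -> i < size rp ->
  nth x0 rp i \in V (w (size rp - i.+1)).
Proof.
elim: rp i => [|v rp IH] [|i] //= /and3P[vV _ frp] ilt; first by rewrite subn1.
by rewrite subSS IH.
Qed.
End WalkEmbedding.

(** * Expansion and trees *)

Lemma subset_of_card (T : finType) (S : {set T}) k : k <= #|S| ->
  exists2 S' : {set T}, S' \subset S & #|S'| = k.
Proof.
move=> kS; exists [set x in take k (enum S)].
  by apply/fintype.subsetP => x; rewrite inE => /mem_take; rewrite mem_enum.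
by rewrite cardsE (card_uniqP _) ?size_takel -?cardE // take_uniq ?enum_uniq.
Qed.

Definition nbrs (T : finType) (E : rel T) (Z : {set T}) : {set T} :=
  [set u | [exists z in Z, E z u]].

Lemma nbrsU (T : finType) (E : rel T) (Z Z' : {set T}) :
  nbrs E (Z :|: Z') \subset nbrs E Z :|: nbrs E Z'.
Proof.
apply/fintype.subsetP => u; rewrite !inE => /exists_inP[z zZ Ezu].
by case/setUP: zZ => zZ; apply/orP; [left|right]; apply/exists_inP; exists z.
Qed.

(** Let [R] be a largest non-expanding set of size at most [3 * h]. It has fewer than [h] points, as
    sets of size [h] to [3 * h] expand. A non-expanding [Z] outside it with at most [2 * h] points
    could be added to [R], against maximality. *)
Lemma expander_core (T : finType) (E : rel T) (W : {set T}) K h :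
  0 < h ->
  (forall Z : {set T}, Z \subset W -> h <= #|Z| <= 3 * h ->
    K * #|Z| < #|(nbrs E Z :&: W) :\: Z|) ->
  exists C : {set T}, [/\ C \subset W, #|W :\: C| < h &
    forall Z : {set T}, Z \subset C -> 0 < #|Z| <= 2 * h ->
      K * #|Z| <= #|(nbrs E Z :&: C) :\: Z|].
Proof.
move=> h0 expW.
pose P (R : {set T}) := [&& R \subset W, #|R| <= 3 * h &
  #|(nbrs E R :&: W) :\: R| <= K * #|R|].
have P0 : P finset.set0.
  rewrite /P finset.sub0set cards0 muln0 leqn0 cards_eq0 /=; apply/eqP/setP => u.
  by rewrite !inE; apply/negP => /and3P[_ /exists_inP[z]]; rewrite inE.
case: (arg_maxnP (fun R : {set T} => #|R|) P0) => R /and3P[RW R3 RK] Rmax.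
have Rh : #|R| < h.
  rewrite ltnNge; apply/negP => hR; have := expW R RW.
  by rewrite hR R3 => /(_ isT); rewrite ltnNge RK.
exists (W :\: R); split; first exact: finset.subsetDl.
  rewrite (leq_ltn_trans _ Rh) //; apply/subset_leq_card/fintype.subsetP => u.
  by rewrite !inE; case: (u \in R) => //=; case: (u \in W).
move=> Z ZC /andP[Z0 Z2]; rewrite leqNgt; apply/negP => ltZ.
have dis : [disjoint R & Z].
  rewrite disjoint_sym disjoint_subset; apply/fintype.subsetP => u.
  by move/(fintype.subsetP ZC); rewrite !inE => /andP[].
have cRZ : #|R :|: Z| = #|R| + #|Z|.
  by have := cardsUI R Z; rewrite (finset.disjoint_setI0 dis) cards0 addn0.
suff /Rmax : P (R :|: Z) by rewrite /= cRZ; lia.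
apply/and3P; split.
- by rewrite finset.subUset RW (fintype.subset_trans ZC) // finset.subsetDl.
- by rewrite cRZ; lia.
rewrite cRZ mulnDr (leq_trans _ (leq_add RK (ltnW ltZ))) //.
apply: leq_trans (leq_card_setU _ _); apply/subset_leq_card/fintype.subsetP => u.
rewrite !inE !negb_or => /andP[/andP[uR uZ]] /andP[uN uW]; rewrite uR uZ uW /= !andbT.
by move: (fintype.subsetP (nbrsU E R Z) u); rewrite !inE; apply.
Qed.

Section Trees.
Variables (T : finType) (E : rel T) (A C : {set T}) (h : nat) (x : T).
Hypothesis bip : forall u v, E u v -> (v \in A) = (u \notin A).
Hypothesis expC : forall Z : {set T}, Z \subset C -> 0 < #|Z| <= 2 * h ->
  9 * #|Z| <= #|(nbrs E Z :&: C) :\: Z|.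

(* [S] is the [j]-th level of a tree hanging from the root [x], with all
   vertices but the root in [U]. *)
Definition tree_level (j : nat) (S U : {set T}) : Prop :=
  [/\ [/\ S \subset U, U \subset C & x \notin U],
    #|S| = 2 ^ j, #|U| <= 2 * 2 ^ j, (forall v, v \in S -> (v \in A) = odd j) &
    forall v, v \in S -> exists q, [/\ size q = j.+1, path E x q, last x q = v,
      uniq q & {subset q <= U}]].

(** Of at least [9 * 2 ^ j] neighbors outside [S], the root, the tree and [Y] exclude at most
    [7 * 2 ^ j]. Here [Y] stands for the other tree. *)
Lemma tree_grow j (S U Y : {set T}) : tree_level j S U -> 2 ^ j <= 2 * h ->
  #|Y| < 5 * 2 ^ j ->
  exists2 S' : {set T}, tree_level j.+1 S' (U :|: S') & [disjoint S' & Y].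
Proof.
move=> [[SU UC xU] cS cU Sodd Sq] jh cY.
have j0 : 0 < 2 ^ j by rewrite expn_gt0.
have := expC (fintype.subset_trans SU UC); rewrite cS j0 jh => /(_ isT) expS.
pose N := (nbrs E S :&: C) :\: (x |: (U :|: Y)).
have cN : 2 ^ j.+1 <= #|N|.
  have : #|(nbrs E S :&: C) :\: S| <= #|N| + #|x |: (U :|: Y)|.
    apply: leq_trans (leq_card_setU _ _); apply/subset_leq_card/fintype.subsetP => u.
    rewrite [u \in N :|: _]inE /N [u \in _ :\: (x |: _)]inE.
    by case: (u \in x |: _) => //=; rewrite ?orbT //= orbF inE => /andP[].
  have cUY : #|U :|: Y| <= #|U| + #|Y| by exact: leq_card_setU.
  have : #|x |: (U :|: Y)| <= 1 + #|U :|: Y|.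
    by rewrite (leq_trans (leq_card_setU _ _)) ?cards1.
  rewrite expnS; lia.
have [S' S'N cS'] := subset_of_card cN.
have S'P v : v \in S' -> [/\ v \in nbrs E S, v \in C, v != x, v \notin U & v \notin Y].
  move/(fintype.subsetP S'N); rewrite inE [v \in x |: _]inE [v \in U :|: _]inE !negb_or.
  by rewrite [v \in _ :&: _]inE inE => /and3P[/and3P[-> -> ->] -> ->].
exists S'; last first.
  rewrite disjoint_subset; apply/fintype.subsetP => v /S'P[_ _ _ _].
  by rewrite inE.
split; first split.
- exact: finset.subsetUr.
- by rewrite finset.subUset UC; apply/fintype.subsetP => v /S'P[].
- by rewrite inE negb_or xU; apply/negP => /S'P[]; rewrite eqxx.
- exact: cS'.
- by rewrite (leq_trans (leq_card_setU _ _)) // cS' expnS; lia.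
- move=> v /S'P[]; rewrite inE => /exists_inP[u uS /bip ->] _ _ _ _ /=.
  by rewrite (Sodd u uS).
move=> v vS'; have [vN _ _ vU _] := S'P v vS'.
move: vN; rewrite inE => /exists_inP[u uS Euv].
have [q [sq pq lq uq qU]] := Sq u uS; exists (rcons q v); split.
- by rewrite size_rcons sq.
- by rewrite rcons_path pq lq.
- by rewrite last_rcons.
- by rewrite rcons_uniq uq andbT; apply: contra vU => /qU.
- move=> z; rewrite mem_rcons inE => /predU1P[->|/qU zU]; rewrite inE ?vS' ?orbT //.
  by rewrite zU.
Qed.

(** The trees grow in turn, each avoiding the other. The second must avoid a tree already one level
    ahead, whose at most [4 * 2 ^ j] vertices stay below the [5 * 2 ^ j] of [tree_grow]. *)
Lemma two_trees j : 0 < h -> x \in C -> x \in A -> 2 ^ j <= 4 * h ->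
  exists S1 U1 S2 U2, [/\ tree_level j S1 U1, tree_level j S2 U2 & [disjoint U1 & U2]].
Proof.
move=> h0 xC xA; elim: j => [_|j IH jh].
  have /expC : [set x] \subset C by rewrite finset.sub1set.
  rewrite cards1 muln_gt0 h0 => /(_ isT) c9.
  have /card_gt1P[y1 [y2 [y1N y2N y12]]] := leq_trans (isT : 1 < 9 * 1) c9.
  have lvl y : y \in (nbrs E [set x] :&: C) :\: [set x] -> tree_level 0 [set y] [set y].
    rewrite !inE => /and3P[yx /exists_inP[z /set1P->] Exy yC].
    split; rewrite ?cards1 ?finset.sub1set ?inE //; first by rewrite eq_sym.
      by move=> v /set1P->; rewrite (bip Exy) xA.
    move=> v /set1P->; exists [:: y]; split=> //=; first by rewrite Exy.
    by move=> z'; rewrite !inE.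
  exists [set y1], [set y1], [set y2], [set y2]; split; try exact: lvl.
  by rewrite disjoints1 inE.
have jh' : 2 ^ j <= 2 * h by move: jh; rewrite expnS; lia.
have [|S1 [U1 [S2 [U2 [t1 t2 dis]]]]] := IH; first by lia.
have j0 : 0 < 2 ^ j by rewrite expn_gt0.
have [|S1' t1' dis1] := tree_grow t1 jh' (Y := U2).
  by case: t2 => _ _ cU2 _ _; lia.
have [|S2' t2' dis2] := tree_grow t2 jh' (Y := U1 :|: S1').
  by case: t1' => _ _ cU1 _ _; move: cU1; rewrite expnS; lia.
exists S1', (U1 :|: S1'), S2', (U2 :|: S2'); split=> //.
rewrite -finset.setI_eq0 finset.setIUr finset.setU_eq0 !finset.setI_eq0 [[disjoint _ & S2']]disjoint_sym dis2 andbT.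
by rewrite -finset.setI_eq0 finset.setIUl finset.setU_eq0 !finset.setI_eq0 dis dis1.
Qed.
End Trees.

(** * Cycles in the blow-up of an odd cycle *)

Lemma joinedC (T : finType) (E : rel T) h (X Y : {set T}) :
  symmetric E -> joined E h X Y -> joined E h Y X.
Proof.
move=> symE jXY X' Y' XX' YY' hX hY; have [u [v [uY vX Euv]]] := jXY _ _ YY' XX' hY hX.
by exists v, u; rewrite symE.
Qed.

Lemma joinedS (T : finType) (E : rel T) h (X Y X' Y' : {set T}) :
  X' \subset X -> Y' \subset Y -> joined E h X Y -> joined E h X' Y'.
Proof.
move=> XX' YY' jXY A B AX BY; apply: jXY; exact: fintype.subset_trans XX' || exact: fintype.subset_trans YY'.
Qed.

(* A walk of odd length [2 * Q + 1] in the cycle with vertices [0, ..., 2 * M],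
   zigzagging about [Q / M] times between [2 * i] and [2 * i + 1] for each
   [i < M] in turn. Both of its ends lie over [0]; there it uses the two extra
   indices [2 * M + 1] and [2 * M + 2], which stand for reserved subsets. *)
Definition zigzag (M Q p : nat) : nat :=
  if p == 0 then 2 * M + 1 else if p == 2 * Q + 1 then 2 * M + 2
  else 2 * (p./2 * M %/ Q) + odd p.

Section Zigzag.
Variables (M Q : nat).
Hypotheses (M0 : 0 < M) (MQ : M <= Q).

Lemma zigzag_inner p : 0 < p < 2 * Q + 1 -> zigzag M Q p < 2 * M + 1.
Proof.
rewrite /zigzag => /andP[]; case: eqP => [->//|_ _]; case: eqP => [->|_ pQ].
  by rewrite ltnn.
have [p2 | p2] := leqP Q p./2.
  have -> : p = Q.*2 by lia.
  by rewrite odd_double doubleK mulKn; lia.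
have : p./2 * M %/ Q < M by rewrite ltn_divLR; nia.
lia.
Qed.

(** As [M <= Q], the quotient rises by at most one between consecutive even positions. An even
    position steps up; an odd one steps back, or up to the next even index. *)
Lemma zigzag_step p : 0 < p < 2 * Q ->
  zigzag M Q p.+1 = (zigzag M Q p).+1 /\ zigzag M Q p < 2 * M \/
  (zigzag M Q p.+1).+1 = zigzag M Q p.
Proof.
move=> /andP[p0 pQ]; rewrite /zigzag.
have -> : (p == 0) = false by lia.
have -> : (p == 2 * Q + 1) = false by lia.
have -> : (p.+1 == 2 * Q + 1) = false by lia.
rewrite [p.+1 == 0]/=.
have : p./2 * M %/ Q < M by rewrite ltn_divLR; nia.
case op: (odd p); last first.
  have -> : p.+1./2 = p./2 by lia.
  by rewrite /= op /=; left; lia.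
have -> : p.+1./2 = (p./2).+1 by lia.
set a := p./2 * M %/ Q => aM.
have [e|e] : (p./2).+1 * M %/ Q = a \/ (p./2).+1 * M %/ Q = a.+1.
  have l1 : a * Q <= p./2 * M by exact: leq_trunc_div.
  have l2 : p./2 * M < a.+1 * Q by rewrite -ltn_divLR //; nia.
  have l3 : a <= (p./2).+1 * M %/ Q by rewrite leq_divRL; nia.
  have l4 : (p./2).+1 * M %/ Q < a.+2 by rewrite ltn_divLR; nia.
  lia.
  by rewrite e /= op /=; right; lia.
by rewrite e /= op /=; left; lia.
Qed.

(** Visits to [a] have the parity of [a], and their halves lie in a half-open interval of length
    [Q / M <= c]. *)
Lemma count_zigzag a c : a < 2 * M + 1 -> Q <= M * c ->
  count (fun p => zigzag M Q p == a) (iota 0 (2 * Q + 2)) <= c.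
Proof.
move=> aM Qc; rewrite -size_filter; set s := seq.filter _ _.
have sP p : p \in s -> [/\ odd p = odd a & a./2 * Q <= p./2 * M < (a./2).+1 * Q].
  rewrite mem_filter mem_iota /zigzag; case: (p =P 0) => [_ /andP[/eqP ea]|_]; first by move: aM; rewrite -ea ltnn.
  case: (p =P 2 * Q + 1) => [_ /andP[/eqP ea]|_ /andP[/eqP <- _]]; first by move: aM; rewrite -ea; lia.
  have -> : (2 * (p./2 * M %/ Q) + odd p)./2 = p./2 * M %/ Q by lia.
  have Q0 : 0 < Q by exact: leq_trans MQ.
  rewrite leq_trunc_div -ltn_divLR // ltnS leqnn; split=> //.
  by rewrite oddD oddM /=; case: (odd p).
(* The interval starts at the ceiling of [a./2 * Q / M]. *)
rewrite -(size_map half) -(size_iota ((a./2 * Q + M.-1) %/ M) c).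
apply: uniq_leq_size.
  rewrite map_inj_in_uniq ?filter_uniq ?iota_uniq // => p p' /sP[op _] /sP[op' _] e.
  by rewrite -[p]odd_double_half -[p']odd_double_half e op op'.
move=> j /mapP[p /sP[_ /andP[l1 l2]] ->]; rewrite mem_iota.
set j0 := (_ %/ _).
have k1 : j0 * M <= a./2 * Q + M.-1 by exact: leq_trunc_div.
have k2 : a./2 * Q + M.-1 < j0.+1 * M by rewrite -ltn_divLR.
by apply/andP; split; nia.
Qed.
End Zigzag.

(** The cycle leaves [x] along [q2], crosses from [a] to [b] and returns along [q1]; [b] is not
    listed separately, being the end of [q1]. *)
Lemma cycle_glue (T : eqType) (E : rel T) x q2 mid q1 a b :
  symmetric E -> path E x q2 -> last x q2 = a -> path E x q1 -> last x q1 = b ->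
  path E a (rcons mid b) -> cycle E (x :: q2 ++ mid ++ rev q1).
Proof.
move=> symE pq2 lq2 pq1 lq1 pm.
have -> : cycle E (x :: q2 ++ mid ++ rev q1) =
    path E x (q2 ++ rcons mid b ++ rev (belast x q1)).
  by rewrite cat_rcons -lq1 -rev_rcons -lastI rev_cons /= !rcons_cat.
rewrite !cat_path pq2 lq2 pm last_rcons -lq1 rev_path /=.
by rewrite -(eq_path (e := E)) // => u v; rewrite symE.
Qed.

Section BlowupCycle.
Variables (T : finType) (E : rel T) (M s h : nat) (V : nat -> {set T}).
Hypotheses (symE : symmetric E) (M0 : 0 < M) (h0 : 0 < h) (hs : 200 * h <= s).
Hypothesis disV : forall a b x, a < 2 * M + 1 -> b < 2 * M + 1 ->
  x \in V a -> x \in V b -> a = b.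
Hypothesis cardV : forall a, a < 2 * M + 1 -> #|V a| = s.
Hypothesis joinV : forall a, a < 2 * M -> joined E h (V a) (V a.+1).
Hypothesis joinV0 : joined E h (V (2 * M)) (V 0).

(** Dropping the edges inside either side makes the graph on [V 0] and [V 1] bipartite, so the
    parity of a tree level tells its class. *)
Let E01 (u v : T) := E u v && ((u \in V 1) (+) (v \in V 1)).

(** A set of at least [4 * h] points has [h] of them in [V 0] or in [V 1], hence reaches all but
    fewer than [h] points of the other class. As [s >= 200 * h], at least [187 * h] of these lie
    outside a set of at most [12 * h] points, more than [9 * 12 * h]. *)
Lemma blowup_expander : exists C : {set T},
  [/\ C \subset V 0 :|: V 1, #|(V 0 :|: V 1) :\: C| < 4 * h &
    forall Z : {set T}, Z \subset C -> 0 < #|Z| <= 2 * (4 * h) ->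
      9 * #|Z| <= #|(nbrs E01 Z :&: C) :\: Z|].
Proof.
have lt1 : 1 < 2 * M + 1 by lia.
have lt0 : 0 < 2 * M + 1 by lia.
have exp1 (Z X Y : {set T}) : h <= #|Z :&: X| -> #|Z| <= 3 * (4 * h) -> #|Y| = s ->
    Y \subset V 0 :|: V 1 -> joined E h X Y ->
    (forall u v, u \in X -> v \in Y -> (u \in V 1) (+) (v \in V 1)) ->
    9 * #|Z| < #|(nbrs E01 Z :&: (V 0 :|: V 1)) :\: Z|.
  move=> hZX Z3 cY YW jXY XY.
  have : #|Y :\: nbrs E01 Z| < h.
    rewrite ltnNge; apply/negP => hY.
    have [u [v [/setIP[uZ uX] /finset.setDP[vY vN] Euv]]] :=
      jXY _ _ (finset.subsetIr Z X) (finset.subsetDl Y (nbrs E01 Z)) hZX hY.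
    move/negP: vN; apply; rewrite inE; apply/exists_inP; exists u => //.
    by rewrite /E01 Euv XY.
  have : #|Y| <= #|Y :\: nbrs E01 Z| + #|(nbrs E01 Z :&: (V 0 :|: V 1)) :\: Z| + #|Z|.
    apply: leq_trans (_ : _ <= #|(Y :\: nbrs E01 Z) :|:
      (nbrs E01 Z :&: (V 0 :|: V 1)) :\: Z :|: Z|) _.
      apply/subset_leq_card/fintype.subsetP => u uY; rewrite !finset.in_setU !finset.in_setD finset.in_setI uY.
      move/fintype.subsetP: YW => /(_ u uY); rewrite finset.in_setU => ->.
      by case: (u \in nbrs _ _); case: (u \in Z).
    by rewrite (leq_trans (leq_card_setU _ _)) // leq_add // leq_card_setU.
  lia.
apply: expander_core; first lia.
move=> Z ZW /andP[hZ Z3].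
have : #|Z| <= #|Z :&: V 0| + #|Z :&: V 1|.
  apply: leq_trans (leq_card_setU _ _).
  by rewrite -finset.setIUr (finset.setIidPl ZW).
have [hZ0 _|hZ0 hZ01] := leqP h #|Z :&: V 0|.
  apply: (exp1 Z (V 0) (V 1)); rewrite ?cardV ?finset.subsetUr //; first by apply: joinV; lia.
  move=> u v u0 ->; case u1: (u \in V 1) => //.
  by have := disV lt0 lt1 u0 u1.
apply: (exp1 Z (V 1) (V 0)); rewrite ?cardV ?finset.subsetUl //; first by lia.
  by apply: joinedC; [|apply: joinV; lia].
move=> u v -> v0; case v1: (v \in V 1) => //.
by have := disV lt0 lt1 v0 v1.
Qed.

Lemma blowup_roots : exists D x (S1 S2 U1 U2 : {set T}), [/\ 2 ^ D <= s,
  [/\ S1 \subset U1 :&: V 0, S2 \subset U2 :&: V 0, 3 * h + 1 < #|S1| & 3 * h + 1 < #|S2|],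
  [/\ #|x |: (U1 :|: U2)| <= 65 * h, [disjoint U1 & U2], x \notin U1 & x \notin U2],
  (forall v, v \in S1 -> exists q, [/\ size q = D.+1, path E x q, last x q = v,
      uniq q & {subset q <= U1}]) &
  (forall v, v \in S2 -> exists q, [/\ size q = D.+1, path E x q, last x q = v,
      uniq q & {subset q <= U2}])].
Proof.
have [C [CW cC expC]] := blowup_expander.
have [x] : exists x, x \in C :&: V 1.
  apply/card_gt0P; rewrite lt0n; apply/negP => /eqP c0.
  have : #|V 1| <= #|(V 0 :|: V 1) :\: C| + #|C :&: V 1|.
    apply: leq_trans (leq_card_setU _ _); apply/subset_leq_card/fintype.subsetP => u u1.
    by rewrite !finset.in_setU finset.in_setD finset.in_setI finset.in_setU u1 orbT; case: (u \in C).
  by rewrite c0 cardV; lia.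
case/setIP => xC x1.
(* [D] is even, so the last levels, [D + 1] steps from the root in [V 1], lie in [V 0]. Powers of 4
   put [2 ^ D] between [4 * h] and [16 * h]. *)
pose D := (trunc_log 4 (4 * h)).+1.*2.
have DE : 2 ^ D = 4 ^ (trunc_log 4 (4 * h)).+1 by rewrite /D -mul2n expnM.
have D1 : 2 ^ D <= 4 * (4 * h).
  by rewrite DE expnS leq_mul2l trunc_logP //; lia.
have D2 : 4 * h < 2 ^ D by rewrite DE trunc_log_ltn.
have bip u v : E01 u v -> (v \in V 1) = (u \notin V 1).
  by case/andP=> _; case: (u \in V 1); case: (v \in V 1).
have [|S1 [U1 [S2 [U2 [t1 t2 dis]]]]] := two_trees bip expC _ xC x1 D1; first by lia.
have path01 q : path E01 x q -> path E x q.
  by apply: sub_path => u v /andP[].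
have S0 S U : tree_level E01 (V 1) C x D S U -> S \subset U :&: V 0.
  case=> [[SU UC _] _ _ Sodd _]; apply/fintype.subsetP => v vS.
  have vU := fintype.subsetP SU v vS; rewrite inE vU.
  have := fintype.subsetP (fintype.subset_trans UC CW) v vU.
  by rewrite inE (Sodd v vS) odd_double orbF.
exists D, x, S1, S2, U1, U2; split=> //.
- by lia.
- by split; try exact: S0; [case: t1|case: t2] => _ -> _ _ _; lia.
- split=> //; try by [case: t1 => [[]]|case: t2 => [[]]].
  have [_ _ c1 _ _] := t1; have [_ _ c2 _ _] := t2.
  have : #|x |: (U1 :|: U2)| <= 1 + (#|U1| + #|U2|).
    by rewrite (leq_trans (leq_card_setU _ _)) // cards1 leq_add2l leq_card_setU.
  lia.
- case: t1 => _ _ _ _ tp v /tp[q [? /path01 ? ? ? ?]]; by exists q.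
- case: t2 => _ _ _ _ tp v /tp[q [? /path01 ? ? ? ?]]; by exists q.
Qed.

(** The root, two tree paths of [D + 1] further vertices and [2 * Q] inner walk vertices make up the
    length. The walk visits a class at most [s - 200 * h] times; the [200 * h] points to spare cover
    the [65 * h] lost to the trees and the slack of the search. *)
Lemma blowup_cycle : exists2 D, 2 ^ D <= s & forall Q, M <= Q <= M * (s - 200 * h) ->
  exists c : seq T, [/\ uniq c, size c = 2 * D + 2 * Q + 3 & cycle E c].
Proof.
have [D [x [S1 [S2 [U1 [U2 [Ds [S1U S2U cS1 cS2] cdU tr1 tr2]]]]]]] := blowup_roots.
exists D => // Q /andP[MQ Qs]; have Q0 : 0 < Q by exact: leq_trans MQ.
pose V' (a : nat) := if a < 2 * M + 1 then V a :\: (x |: (U1 :|: U2))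
  else if a == 2 * M + 1 then S1 else if a == 2 * M + 2 then S2 else finset.set0.
have V'1 : V' (2 * M + 1) = S1 by rewrite /V' ltnn eqxx.
have V'2 : V' (2 * M + 2) = S2.
  by rewrite /V' ltn_add2l ltnNge /= eqn_add2l /= eqxx.
have V'in a : a < 2 * M + 1 -> V' a = V a :\: (x |: (U1 :|: U2)) by rewrite /V' => ->.
have V'sub a : a < 2 * M + 1 -> V' a \subset V a by move=> /V'in->; exact: finset.subsetDl.
have S1V : S1 \subset V 0 by exact: fintype.subset_trans S1U (finset.subsetIr _ _).
have S2V : S2 \subset V 0 by exact: fintype.subset_trans S2U (finset.subsetIr _ _).
have S1U1 : S1 \subset U1 by exact: fintype.subset_trans S1U (finset.subsetIl _ _).
have S2U2 : S2 \subset U2 by exact: fintype.subset_trans S2U (finset.subsetIl _ _).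
(* A label telling the reserved classes from each other and from the rest, where the disjointness of
   [V] applies. *)
pose part (y : T) := if y \in U1 then 2 * M + 1 else if y \in U2 then 2 * M + 2 else 0.
have V'part a y : y \in V' a -> part y = (if a < 2 * M + 1 then 0 else a).
  rewrite /V' /part; case: ltnP => [aM|aM].
    rewrite !inE !negb_or => /andP[/and3P[_ /negbTE-> /negbTE->]] //.
  case: eqP => [->|_]; first by move/(fintype.subsetP S1U1) ->.
  case: eqP => [->|_]; last by rewrite inE.
  move/(fintype.subsetP S2U2) => yU2; rewrite yU2.
  by have [_ dU _ _] := cdU; rewrite (disjointFl dU yU2).
have disV' a b y : y \in V' a -> y \in V' b -> a = b.
  move=> ya yb; have := V'part _ _ ya; rewrite (V'part _ _ yb).
  case: ltnP => bM; case: ltnP => aM; try by move=> e; move: aM bM; clear -e; lia.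
  by move=> _; apply: (disV aM bM) ((fintype.subsetP (V'sub _ aM)) _ ya)
      ((fintype.subsetP (V'sub _ bM)) _ yb).
pose w := zigzag M Q.
have w0 : w 0 = 2 * M + 1 by [].
have wL : w (2 * Q + 1) = 2 * M + 2.
  by rewrite /w /zigzag; case: eqP => [|_]; [lia | rewrite eqxx].
have w1 : w 1 = 1.
  by rewrite /w /zigzag /=; case: eqP => [|_]; [lia | rewrite mul0n div0n].
have wQ : w (2 * Q) = 2 * M.
  rewrite /w /zigzag; do 2 (case: eqP => [|_]; first lia).
  by rewrite (mul2n Q) doubleK odd_double mulKn ?addn0.
(* The step upward, with two exceptions: the walk goes from [S1] into class 1, and from class
   [2 * M] into [S2] by the closing pair of the odd cycle. *)
pose n1 (a : nat) := if a == 2 * M + 1 then 1 else if a == 2 * M then 2 * M + 2 else a.+1.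
have succw p : p < 2 * Q + 1 -> w p.+1 = n1 (w p) \/ w p.+1 = (w p).-1.
  rewrite addn1 ltnS leq_eqVlt => /predU1P[->|pQ].
    by left; rewrite -[(2 * Q).+1]addn1 wL wQ /n1 eqxx; case: eqP => [|_]; [lia|].
  have [->|p0] := posnP p; first by left; rewrite w0 w1 /n1 eqxx.
  have := zigzag_step M0 MQ (p := p); rewrite p0 pQ => /(_ isT) [[wp wpM]|wp].
    left; rewrite /n1 -/(w p) -/(w p.+1) in wp wpM *.
    by rewrite wp; case: eqP => [e|_]; [lia|case: eqP => [e|_]; [lia|]].
  by right; rewrite -[w p]wp.
have joinw p : p < 2 * Q + 1 -> joined E h (V' (w p)) (V' (w p.+1)).
  rewrite addn1 ltnS leq_eqVlt => /predU1P[->|pQ].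
    rewrite -[(2 * Q).+1]addn1 wL wQ V'2; apply: joinedS joinV0 => //.
    by apply: V'sub; lia.
  have [->|p0] := posnP p.
    rewrite w0 w1 V'1; apply: (joinedS (X := V 0) (Y := V 1)) => //.
      by apply: V'sub; lia.
    by apply: joinV; lia.
  have wpM : w p < 2 * M + 1 by apply: zigzag_inner => //; lia.
  have wpM' : w p.+1 < 2 * M + 1 by apply: zigzag_inner => //; lia.
  have := zigzag_step M0 MQ (p := p); rewrite p0 pQ => /(_ isT) [[wp wpM2]|wp].
    by apply: joinedS (V'sub _ wpM) (V'sub _ wpM') _; rewrite /w wp; exact: joinV.
  apply: joinedS (V'sub _ wpM) (V'sub _ wpM') _; apply: joinedC => //.
  by rewrite /w -wp; apply: joinV; move: wpM; rewrite /w -wp; lia.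
have cardV' p : p <= 2 * Q + 1 ->
    count (fun q => w q == w p) (iota 0 (2 * Q + 1).+1) + 3 * h + 1 <= #|V' (w p)|.
  move=> pQ; rewrite -addnS.
  have ends_once a b : (forall q, q < 2 * Q + 2 -> w q = a -> q = b) ->
      count (fun q => w q == a) (iota 0 (2 * Q + 2)) <= 1.
    move=> wa; rewrite -size_filter -[1]/(size [:: b]); apply: uniq_leq_size.
      by rewrite filter_uniq ?iota_uniq.
    move=> q; rewrite mem_filter mem_iota inE => /and3P[/eqP wq _ qQ].
    by apply/eqP; apply: wa.
  have inner q : q < 2 * Q + 2 -> q <> 0 -> q <> 2 * Q + 1 -> w q < 2 * M + 1.
    by move=> qQ q0 qL; apply: zigzag_inner => //; lia.
  have [p0|p0] := posnP p.
    rewrite p0 w0 V'1; have : count (fun q => w q == 2 * M + 1) (iota 0 (2 * Q + 2)) <= 1.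
      apply: (ends_once _ 0) => q qQ wq; case: (q =P 0) => // q0.
      case: (q =P 2 * Q + 1) => qL; first by move: wq; rewrite qL wL; lia.
      by have := inner q qQ q0 qL; rewrite wq ltnn.
    lia.
  have [pL|pL] := eqVneq p (2 * Q + 1).
    rewrite pL wL V'2; have : count (fun q => w q == 2 * M + 2) (iota 0 (2 * Q + 2)) <= 1.
      apply: (ends_once _ (2 * Q + 1)) => q qQ wq; case: (q =P 2 * Q + 1) => // qL.
      case: (q =P 0) => q0; first by move: wq; rewrite q0 w0; lia.
      by have := inner q qQ q0 qL; rewrite wq; lia.
    lia.
  have wpM : w p < 2 * M + 1 by apply: zigzag_inner => //; lia.
  have := count_zigzag M0 MQ wpM Qs; rewrite -/w.
  have : #|V (w p)| <= #|V' (w p)| + #|x |: (U1 :|: U2)|.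
    rewrite V'in //; apply: leq_trans (leq_card_setU _ _).
    apply/subset_leq_card/fintype.subsetP => u uV.
    by rewrite finset.in_setU finset.in_setD uV; case: (u \in x |: _).
  by have [cU _ _ _] := cdU; rewrite cardV //; clear -cU hs Q0 h0; lia.
have [rp [srp urp frp]] := walk_embedding disV' succw joinw cardV'.
have nthV i := follows_nth x frp (i := i); rewrite srp in nthV.
move: (follows_sorted symE frp) => {frp} Erp.
case: rp srp urp Erp nthV => [|a rp] //= [srp] urp Erp nthV.
case/lastP: rp srp urp Erp nthV => [|mid b]; first by case; rewrite addn1.
rewrite size_rcons => srp urp Erp nthV.
have smid : size mid = 2 * Q by apply/eqP; rewrite -eqSS srp addn1.
(* The path is stored in reverse: its head [a] ends the walk and its last entry [b] starts it. *)
have aS2 : a \in S2.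
  by have := nthV 0 isT; rewrite subn1 /= wL V'2.
have bS1 : b \in S1.
  have := nthV (2 * Q + 1); rewrite ltnS leqnn => /(_ isT).
  by rewrite subnn w0 V'1 addn1 /= nth_rcons smid ltnn eqxx.
have midU y : y \in mid -> [/\ y != x, y \notin U1 & y \notin U2].
  move=> ym; have [i iQ <-] : exists2 i, i < 2 * Q & nth x mid i = y.
    by exists (index y mid); rewrite ?nth_index // -smid index_mem.
  have iQ' : i.+1 < (2 * Q + 1).+1 by rewrite addn1 ltnW.
  have wM : w ((2 * Q + 1).+1 - i.+2) < 2 * M + 1.
    by apply: zigzag_inner; rewrite ?M0 ?MQ //; clear -iQ; lia.
  have := nthV i.+1 iQ'; rewrite /= nth_rcons smid iQ V'in //.
  by rewrite !inE !negb_or => /andP[/and3P[-> -> ->]].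
have [q2 [sq2 pq2 lq2 uq2 qU2]] := tr2 a aS2.
have [q1 [sq1 pq1 lq1 uq1 qU1]] := tr1 b bS1.
have [_ dU xU1 xU2] := cdU; exists (x :: q2 ++ mid ++ rev q1); split.
- rewrite /= !mem_cat mem_rev !cat_uniq rev_uniq uq1 uq2 !negb_or.
  have -> : uniq mid by move: urp; rewrite rcons_uniq => /and3P[].
  have -> : x \notin q2 by apply: contra xU2 => /qU2.
  have -> : x \notin q1 by apply: contra xU1 => /qU1.
  have -> : x \notin mid by apply/negP => /midU[]; rewrite eqxx.
  rewrite /= !andbT; apply/andP; split.
    apply/hasPn => y; rewrite mem_cat mem_rev => /orP[/midU[_ _]|/qU1 yU1].
      by apply: contra => /qU2.
    by apply/negP => /qU2 yU2; rewrite (disjointFr dU yU1) in yU2.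
  by apply/hasPn => y; rewrite mem_rev => /qU1 yU1; apply/negP => /midU[_]; rewrite yU1.
- by rewrite [size _]/= !size_cat size_rev sq1 sq2 smid; clear; lia.
- exact: cycle_glue pq2 lq2 pq1 lq1 Erp.
Qed.
End BlowupCycle.

(** * Partitions into joined classes *)

(** Greedy choice, with [U] the points used so far. Before each new piece more than [#|K| * s]
    points remain, so some fiber of [f] still holds [s] of them. *)
Lemma equal_pieces (T K : finType) (f : T -> K) s k : 0 < s -> (k + #|K|) * s <= #|T| ->
  exists V : 'I_k -> {set T}, [/\ forall a, #|V a| = s,
    forall a x y, x \in V a -> y \in V a -> f x = f y &
    forall a b x, x \in V a -> x \in V b -> a = b].
Proof.
move=> s0 ks; suff [V [U [cV fV dV _ _]]] : exists (V : nat -> {set T}) (U : {set T}),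
    [/\ forall a, a < k -> #|V a| = s,
        forall a x y, a < k -> x \in V a -> y \in V a -> f x = f y,
        forall a b x, a < k -> b < k -> x \in V a -> x \in V b -> a = b,
        forall a x, a < k -> x \in V a -> x \in U & #|U| <= k * s].
  exists (fun a : 'I_k => V a); split=> [a|a x y xa ya|a b x xa xb]; first by apply: cV.
    exact: fV (ltn_ord a) xa ya.
  by apply: val_inj; apply: (dV _ _ x) => /=.
elim: k ks => [_|k IH ks].
  by exists (fun=> finset.set0), finset.set0; split; rewrite ?cards0.
have [|V [U [cV fV dV VU cU]]] := IH; first by apply: leq_trans ks; lia.
have [y ys] : exists y, s <= #|[set x in ~: U | f x == y]|.
  apply: contrapT => /forallNP nf.
  have : #|~: U| <= #|K| * s.
    rewrite -sum1_card (partition_big f xpredT) //= -sum_nat_const leq_sum // => y _.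
    rewrite sum1_card leqNgt; apply/negP => lt_s; apply: (nf y).
    by apply: leq_trans (ltnW lt_s) _; apply/subset_leq_card/fintype.subsetP => x; rewrite unfold_in !inE.
  have := cardsC U; nia.
have [S SX cS] := subset_of_card ys.
have SP x : x \in S -> (x \notin U) * (f x = y).
  by move/(fintype.subsetP SX); rewrite !inE => /andP[-> /eqP].
exists (fun a => if a < k then V a else S), (U :|: S); split.
- by move=> a _; case: ifP => // ak; exact: cV.
- move=> a x z _; case: ifP => ak; first exact: fV.
  by move=> /SP[_ ->] /SP[_ ->].
- move=> a b x ak bk; case: ifP => ak'; case: ifP => bk'; first exact: dV.
  + by move=> /(VU _ _ ak') xU /SP[]; rewrite xU.
  + by move=> /SP[+ _] /(VU _ _ bk') => /negbTE->.
  + by move=> _ _; lia.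
- by move=> a x _; case: ifP => [ak /(VU _ _ ak) xU|_ xS]; rewrite inE ?xU ?xS ?orbT.
- by rewrite (leq_trans (leq_card_setU _ _)) // cS; lia.
Qed.

(** * Energy increment by refinement *)

Section Energy.
Variables (r : nat) (T : finType) (E : 'I_r -> rel T).

(* Its size is the potential of the regularity argument: the pairs of points
   whose classes span no edge of color [t.1]. It grows under refinement, and
   refining by a hole of a pair that spans an edge adds the whole hole. *)
Definition hole_set (K : finType) (f : T -> K) : {set 'I_r * (T * T)} :=
  [set t | [forall u, forall v, (f u == f t.2.1) && (f v == f t.2.2) ==> ~~ E t.1 u v]].

Lemma card_hole_set (K : finType) (f : T -> K) : #|hole_set f| <= r * #|T| ^ 2.
Proof.
by rewrite (leq_trans (max_card _)) // !card_prod card_ord mulnn.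
Qed.

Definition bad_pairs k (V : 'I_k -> {set T}) h : {set 'I_k * 'I_k} :=
  [set ab : 'I_k * 'I_k | (ab.1 < ab.2) &&
    ~~ `[< exists c, joined (E c) h (V ab.1) (V ab.2) >]].

(** A bad pair spans an edge of some color [c] but is not joined in [c], so it contains a hole of
    that color with sides at least [h]. [f'] adds to each point its membership in all these sides.
    Holes of distinct pairs are disjoint, and none was counted for [f], whose classes contain the
    edge. *)
Lemma hole_refine (K : finType) (f : T -> K) k (V : 'I_k -> {set T}) h (c0 : 'I_r) :
  (forall a x y, x \in V a -> y \in V a -> f x = f y) ->
  (forall a b x, x \in V a -> x \in V b -> a = b) ->
  (forall a b, a != b -> exists c x y, [/\ x \in V a, y \in V b & E c x y]) ->
  exists f' : T -> K * {ffun 'I_k * 'I_k -> bool * bool},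
    #|hole_set f| + #|bad_pairs V h| * h ^ 2 <= #|hole_set f'|.
Proof.
move=> fV dV edgeV; set B := bad_pairs V h.
pose goodF (ab : 'I_k * 'I_k) (G : 'I_r * ({set T} * {set T})) := ab \in B ->
  [/\ G.2.1 \subset V ab.1, G.2.2 \subset V ab.2, h <= #|G.2.1|, h <= #|G.2.2| &
    (forall x y, x \in G.2.1 -> y \in G.2.2 -> ~~ E G.1 x y) /\
    exists x y, [/\ x \in V ab.1, y \in V ab.2 & E G.1 x y]].
have [|F FP] := @choice _ _ goodF.
  move=> ab; rewrite /goodF; case: (boolP (ab \in B)) => [|abB]; last first.
    by exists (c0, (finset.set0, finset.set0)).
  rewrite inE => /andP[lt_ab /asboolPn nj].
  have [|c [x [y [xa yb Exy]]]] := edgeV ab.1 ab.2; first by rewrite neq_ltn lt_ab.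
  have : ~ joined (E c) h (V ab.1) (V ab.2) by move=> j; apply: nj; exists c.
  move=> /existsNP[X /existsNP[Y]].
  move=> /not_implyP[XV /not_implyP[YV /not_implyP[hX /not_implyP[hY nE]]]].
  exists (c, (X, Y)); split=> //=; split; last by exists x, y.
  by move=> x' y' x'X y'Y; apply/negP => Exy'; apply: nE; exists x', y'.
pose f' x := (f x, [ffun ab => (x \in (F ab).2.1, x \in (F ab).2.2)]).
exists f'.
have sub : hole_set f \subset hole_set f'.
  apply/fintype.subsetP => t; rewrite !inE => /forallP ht; apply/forallP => u.
  apply/forallP => v; apply/implyP => /andP[/eqP[fu _] /eqP[fv _]].
  by move/forallP: (ht u) => /(_ v); rewrite fu fv !eqxx.
pose R ab := if ab \in B then finset.setX [set (F ab).1] (finset.setX (F ab).2.1 (F ab).2.2)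
  else finset.set0.
have RP t ab : t \in R ab -> [/\ ab \in B, t.1 = (F ab).1, t.2.1 \in (F ab).2.1 &
    t.2.2 \in (F ab).2.2].
  rewrite /R; case: ifP; last by move=> _; rewrite finset.in_set0.
  by case: t => c [x y] _; rewrite !finset.in_setX finset.in_set1 => /and3P[/eqP-> -> ->].
have disR ab ab' : ab != ab' -> [disjoint R ab & R ab'].
  move=> neq; rewrite disjoint_subset; apply/fintype.subsetP => t /RP[abB _ ta tb].
  rewrite inE; apply: contra neq => /RP[abB' _ ta' tb'].
  have [Xa Yb _ _ _] := FP _ abB; have [Xa' Yb' _ _ _] := FP _ abB'.
  rewrite -pair_eqE /=; apply/andP; split; apply/eqP.
    exact: dV (fintype.subsetP Xa _ ta) (fintype.subsetP Xa' _ ta').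
  exact: dV (fintype.subsetP Yb _ tb) (fintype.subsetP Yb' _ tb').
have subR : \bigcup_ab R ab \subset hole_set f' :\: hole_set f.
  apply/finset.bigcupsP => ab _; apply/fintype.subsetP => t /RP[abB tc ta tb].
  have [Xa Yb _ _ [nE [x [y [xa yb Exy]]]]] := FP _ abB.
  rewrite !inE; apply/andP; split.
    apply/negP => /forallP/(_ x)/forallP/(_ y); rewrite tc Exy.
    by rewrite (fV _ _ _ xa (fintype.subsetP Xa _ ta)) (fV _ _ _ yb (fintype.subsetP Yb _ tb)) !eqxx.
  apply/forallP => u; apply/forallP => v; apply/implyP => /andP[/eqP[_ /ffunP fu] /eqP[_ /ffunP fv]].
  rewrite tc; apply: nE.
    by have := fu ab; rewrite !ffunE => -[-> _].
  by have := fv ab; rewrite !ffunE => -[_ ->].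
rewrite -(cardsID (hole_set f) (hole_set f')) (finset.setIidPr sub) leq_add2l.
have cR : #|\bigcup_ab R ab| = \sum_ab #|R ab|.
  rewrite -sum1_card partition_disjoint_bigcup //.
  by apply: eq_bigr => ab _; rewrite sum1_card.
rewrite (leq_trans _ (subset_leq_card subR)) // cR.
rewrite (bigID (mem B)) /= (leq_trans _ (leq_addr _ _)) // -sum_nat_const leq_sum // => ab abB.
rewrite /R abB !cardsX cards1 mul1n -mulnn.
by have [_ _ hX hY _] := FP _ abB; rewrite leq_mul.
Qed.
Definition well_spread N := forall X Y : {set T}, [disjoint X & Y] ->
  #|T| <= N * #|X| -> #|T| <= N * #|Y| ->
  exists c x y, [/\ x \in X, y \in Y & E c x y].

(** Fractions are encoded by denominators: a share [1 / g] of the points may stay uncovered,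
    joinedness is tested at [1 / e] of a class, and a share [1 / e'] of the pairs may be bad. *)
Definition regular_pieces N k0 g e e' := exists k s (V : 'I_k -> {set T}),
  [/\ k0 <= k <= N, #|T| <= N * s, k * s <= #|T| /\ g.-1 * #|T| <= g * (k * s),
    (forall a, #|V a| = s) /\ (forall a b x, x \in V a -> x \in V b -> a = b) &
    e' * #|bad_pairs V (s %/ e)| <= 'C(k, 2)].
End Energy.

(** In [iter], [i] bounds the refinements still possible, each worth [#|T| ^ 2 / B] of potential.
    [K] is quantified before [N], because the number of cells, and with it [N], grows at each
    refinement. *)
Lemma regular_pieces_exist r k0 g e e' : 0 < r -> 1 < g -> 0 < e -> 0 < e' ->
  exists N, forall (T : finType) (E : 'I_r -> rel T), N <= #|T| ->
    well_spread E N -> regular_pieces E N k0 g e e'.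
Proof.
(* For [b] bad pairs and [t = s %/ e], the bounds [n <= 2 * (k * s)], [s <= 2 * e * t] and
   [k ^ 2 <= 4 * e' * b] give [n ^ 2 <= B * (b * t ^ 2)]. *)
move=> r0 g1 e0 e'0; pose B := 64 * e ^ 2 * e'.
suff iter i : forall K : finType, exists N, forall (T : finType) (E : 'I_r -> rel T)
    (f : T -> K), N <= #|T| -> well_spread E N ->
    B * (r * #|T| ^ 2) < B * #|hole_set E f| + i * #|T| ^ 2 -> regular_pieces E N k0 g e e'.
  have [N HN] := iter (B * r).+1 unit; exists N.+1 => T E NT sp.
  have [||k [s [V [/andP[k0k kN] sN ks cdV bV]]]] := HN T E (fun=> tt) (ltnW NT).
  - move=> X Y dXY hX hY; apply: sp => //.
      by rewrite (leq_trans hX) // leq_mul2r leqnSn orbT.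
    by rewrite (leq_trans hY) // leq_mul2r leqnSn orbT.
  - have : 0 < #|T| ^ 2 by rewrite expn_gt0 (leq_trans _ NT).
    lia.
  exists k, s, V; split=> //; first by rewrite k0k (leq_trans kN).
  by rewrite (leq_trans sN) // leq_mul2r leqnSn orbT.
elim: i => [|i IH] K.
  exists 0 => T E f _ _; rewrite mul0n addn0 ltnNge leq_mul2l.
  by rewrite card_hole_set orbT.
(* The cells waste up to [q] pieces, a share of at most [1 / (2 * g)] by [2 * g * q <= k]; the other
   half of [1 / g] pays for rounding [s]. *)
pose q := #|K|; pose k := k0 + 2 + 2 * g * q.
have [N' HN'] := IH (K * {ffun 'I_k * 'I_k -> bool * bool})%type.
exists (N' + (k + q).+1 * (4 * g + e + 2)) => T E f NT sp lt_energy.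
set N := N' + _ in NT sp *; set n := #|T| in NT sp lt_energy *.
have N'N : N' <= N by exact: leq_addr.
pose s := n %/ (k + q).
have kq0 : 0 < k + q by rewrite /k; lia.
have s1 : (k + q) * s <= n by rewrite mulnC leq_trunc_div.
have s2 : n < (k + q) * s.+1 by rewrite mulnC -ltn_divLR.
have s3 : 4 * g + e + 2 <= s.
  by rewrite leq_divRL // (leq_trans _ NT) // (leq_trans _ (leq_addl _ _)) // mulnC leq_mul2r leqnSn orbT.
have kN : k <= N.
  apply: leq_trans (leq_addl _ _); apply: leq_trans (_ : (k + q).+1 <= _); first by lia.
  by rewrite leq_pmulr //; lia.
have qk : 2 * g * q <= k by rewrite /k leq_addl.
have nN : n <= N * s.
  apply: leq_trans (ltnW s2) _; apply: leq_trans (_ : (k + q) * (2 * s) <= _).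
    by rewrite leq_mul2l; apply/orP; right; lia.
  rewrite mulnA leq_mul2r; apply/orP; right; apply: leq_trans (leq_addl _ _).
  by apply: leq_mul; lia.
have nks : g.-1 * n <= g * (k * s).
  apply: leq_trans (_ : g.-1 * ((k + q) * s.+1) <= _); first by rewrite leq_mul2l ltnW ?orbT.
  have [G eG] : exists G, g = G.+1 by exists g.-1; rewrite prednK // ltnW.
  rewrite eG /= in qk s3 *.
  have h1 : 2 * (G * q) * s <= k * s.
    by rewrite leq_mul2r; apply/orP; right; apply: leq_trans qk; rewrite mulnA leq_mul2r; lia.
  have h2 : (4 * G) * k <= s * k by rewrite leq_mul2r; apply/orP; right; lia.
  have h3 : G * q <= G * k.
    by rewrite leq_mul2l; apply/orP; right; apply: leq_trans qk; rewrite leq_pmull.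
  lia.
have [|V [cV fV dV]] := @equal_pieces T K f s k _ s1; first by lia.
have [good|bad] := leqP (e' * #|bad_pairs E V (s %/ e)|) 'C(k, 2).
  exists k, s, V; split=> //; first by rewrite kN andbT /k; lia.
  by split=> //; apply: leq_trans s1; rewrite leq_mul2r leq_addr orbT.
have edgeV a b : a != b -> exists c x y, [/\ x \in V a, y \in V b & E c x y].
  move=> neq; apply: sp; rewrite ?cV //.
  rewrite disjoint_subset; apply/fintype.subsetP => x xa; rewrite inE.
  by apply: contra neq => /(dV _ _ _ xa) ->.
have [f' gain] := hole_refine (s %/ e) (Ordinal r0) fV dV edgeV.
have [||k' [s' [V' [/andP[k0k' kN'] sN' ks' cdV' bV']]]] := HN' T E f' (leq_trans N'N NT).
- move=> X Y dXY hX hY; apply: sp => //.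
    by rewrite (leq_trans hX) // leq_mul2r N'N orbT.
  by rewrite (leq_trans hY) // leq_mul2r N'N orbT.
- have cardn : n ^ 2 <= B * (#|bad_pairs E V (s %/ e)| * (s %/ e) ^ 2).
    set b := #|_| in bad *; set t := s %/ e.
    have t0 : 0 < t by rewrite divn_gt0 //; lia.
    have t1 : s <= 2 * e * t.
      have : s < t.+1 * e by rewrite -ltn_divLR.
      have : e <= e * t by rewrite leq_pmulr.
      by rewrite mulSn (mulnC t); lia.
    have k2 : 2 <= k by rewrite /k; lia.
    have b1 : k ^ 2 <= 4 * e' * b.
      have kk : 2 * k <= k ^ 2 by rewrite -mulnn leq_mul2r k2 orbT.
      have k3 : k ^ 2 = k * k.-1 + k by rewrite addnC -mulnS prednK ?mulnn // ltnW.
      have : k * k.-1 <= ((k * k.-1)./2).*2.+1 by lia.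
      by move: bad; rewrite bin2; lia.
    have n2 : n <= 2 * (k * s).
      have G0 : 0 < g.-1 by lia.
      rewrite -(leq_pmul2l G0) (leq_trans nks) // (mulnA _ 2) leq_mul2r.
      by apply/orP; right; lia.
    apply: leq_trans (_ : (2 * (k * s)) ^ 2 <= _); first by rewrite leq_sqr.
    apply: leq_trans (_ : 4 * ((4 * e' * b) * (2 * e * t) ^ 2) <= _).
      by rewrite expnMn expnMn leq_mul2l leq_mul ?orbT // leq_sqr.
    by rewrite /B !expnMn; lia.
  have le_gain := leq_mul (leqnn B) gain; rewrite mulnDr in le_gain.
  apply: leq_trans lt_energy _; rewrite mulSn addnA leq_add2r.
  by apply: leq_trans le_gain; rewrite leq_add2l.
exists k', s', V'; split=> //; first by rewrite k0k' (leq_trans kN').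
by rewrite (leq_trans sN') // leq_mul2r N'N orbT.
Qed.
End Combinatorics.

(** * The reduced graph *)

Section ColoredGraphs.
Set Implicit Arguments.
Unset Strict Implicit.
Unset Printing Implicit Defensive.
Local Open Scope bool_scope.
Local Open Scope nat_scope.
Local Open Scope set_scope.

Definition color_rel (r : nat) (T : finType) (G : sgraph T) (c : {set T} -> 'I_r)
    (i : 'I_r) : rel T :=
  fun x y => ([set x; y] \in edges G) && (c [set x; y] == i).

Lemma color_rel_sym r (T : finType) (G : sgraph T) (c : {set T} -> 'I_r) i :
  symmetric (color_rel G c i).
Proof. by move=> x y; rewrite /color_rel finset.setUC. Qed.

Lemma mono_cycle r (T : finType) (G : sgraph T) (c : {set T} -> 'I_r) i t (s : seq T) :
  uniq s -> size s = t -> cycle (color_rel G c i) s -> mono_copy G c i (cycle_graph t).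
Proof.
move=> us st cs; case: t st => [|t] st.
  exists (fun a : 'I_0 => False_rect T (Bool.diff_false_true (valP a))).
  by split=> [[]//|e /imsetP[[]]].
case: s us st cs => [//|x0 s] us [st] cs.
exists (fun a : 'I_t.+1 => nth x0 (x0 :: s) a); split=> [a b /eqP|].
  by rewrite nth_uniq //= ?st // => /eqP/val_inj.
move=> e /imsetP[a _ ->].
rewrite imsetU1 imset_set1.
have : color_rel G c i (nth x0 (x0 :: s) a) (nth x0 (x0 :: s) (ordS a)).
  have /(pathP x0)/(_ a) := cs; rewrite size_rcons st ltn_ord => /(_ isT).
  rewrite -rcons_cons nth_rcons /= st ltn_ord.
  rewrite nth_rcons st; case: (ltngtP a t) => [at_|ta|->].
  - by rewrite modn_small.
  - by move: (ltn_ord a); rewrite ltnS leqNgt ta.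
  - by rewrite modnn.
by case/andP => -> /eqP.
Qed.

Section ReducedGraph.
Variables (r : nat) (T : finType) (E : 'I_r -> rel T) (k h : nat) (V : 'I_k -> {set T}).
Hypothesis symE : forall c, symmetric (E c).

Let bad_edges := [set [set ab.1; ab.2] | ab in bad_pairs E V h].

Lemma reduced_sub : pairs 'I_k :\: bad_edges \subset pairs 'I_k.
Proof. exact: finset.subsetDl. Qed.

Definition reduced_graph : sgraph 'I_k :=
  exist (fun D : {set {set 'I_k}} => is_true (D \subset pairs 'I_k)) _ reduced_sub.

Lemma card_reduced : 'C(k, 2) <= #|edges reduced_graph| + #|bad_pairs E V h|.
Proof.
have -> : 'C(k, 2) = #|pairs 'I_k| by rewrite card_draws card_ord.
rewrite -(cardsID bad_edges (pairs 'I_k)) addnC leq_add2l.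
by rewrite (leq_trans (subset_leq_card (finset.subsetIr _ _))) // leq_imset_card.
Qed.

(** An edge takes any color in which its classes are joined; the given color fills in for all other
    sets. *)
Lemma reduced_coloring : 'I_r -> exists col : {set 'I_k} -> 'I_r,
  forall a b, [set a; b] \in edges reduced_graph ->
    joined (E (col [set a; b])) h (V a) (V b).
Proof.
move=> c0; pose good (e : {set 'I_k}) c := e \in edges reduced_graph ->
  forall a b, e = [set a; b] -> joined (E c) h (V a) (V b).
have [|col colP] := @choice _ _ good; last by exists col => a b eE; exact: colP eE _ _ erefl.
move=> e; have [eE|neE] := boolP (e \in edges reduced_graph); last first.
  by exists c0 => eE; rewrite eE in neE.
move: (eE); rewrite inE => /andP[nbad ep]; move: ep; rewrite /pairs inE => /cards2P[a0 [b0 [neq0 e0]]].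
wlog lt0 : a0 b0 neq0 e0 / a0 < b0.
  move=> gen; case: (ltngtP a0 b0) => [||/val_inj/eqP]; first exact: gen.
    by apply: gen; rewrite 1?eq_sym // e0 finset.setUC.
  by rewrite (negbTE neq0).
have [c jc] : exists c, joined (E c) h (V a0) (V b0).
  apply: contrapT => nj; move/negP: nbad; apply; apply/imsetP; exists (a0, b0) => //.
  by rewrite inE lt0 /=; apply/asboolPn.
exists c => _ a b eab; have : a \in e /\ b \in e by rewrite eab !inE !eqxx orbT.
have neq : a != b.
  by apply/eqP => ab; move: (cards2 a0 b0); rewrite -e0 eab ab finset.setUid cards1 neq0.
rewrite e0 !inE => -[/orP[]/eqP ea /orP[]/eqP eb]; move: neq; rewrite ea eb ?eqxx //.
by move=> _; apply: joinedC.
Qed.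
End ReducedGraph.

Lemma oddfloor_lower (R : realType) (l : R) : (1 <= l)%R -> (l < (oddfloor l).+2%:R)%R.
Proof.
move=> l1; have l0 : (0 <= l)%R by exact: le_trans l1.
apply: (@lt_le_trans _ _ (Num.truncn l).+1%:R); first by rewrite truncnS_gt.
by rewrite ler_nat /oddfloor; case: ifP => _ //; rewrite ltnS leqSpred.
Qed.

(** Three losses, each at most [rho * n / 4]: [lam] times the [d] uncovered points, [200 * h] points
    in each of up to [k] classes, and [3 * s] from rounding [lam * k] down to [2 * M]. *)
Lemma length_budget (R : realType) (lam rho : R) (n g e k s M t : nat) :
  (0 <= lam)%R -> (0 < rho)%R -> (4 * lam <= rho * g%:R)%R -> (800 <= rho * e%:R)%R ->
  (12 <= rho * k%:R)%R -> (lam * k%:R < (2 * M + 3)%:R)%R ->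
  (t%:R <= (lam - rho) * n%:R)%R ->
  k * s <= n -> g.-1 * n <= g * (k * s) -> 2 * M <= k -> 0 < g ->
  t <= 2 * (M * (s - 200 * (s %/ e))).
Proof.
move=> lam0 rho0 hg he hk hM ht ksn gks Mk g0; rewrite -(ler_nat R) (le_trans ht) //.
set h := s %/ e; pose d := n - k * s.
have nE : n = d + k * s by rewrite /d subnK.
have gd : g * d <= n.
  by rewrite /d mulnBr leq_subLR (leq_trans _ (leq_add gks (leqnn n))) // addnC -mulSn prednK.
have lower : ((2 * M)%:R * (s%:R - 200 * h%:R) <= (2 * (M * (s - 200 * h)))%:R :> R)%R.
  rewrite (mulnA 2) (natrM _ (2 * M)) ler_wpM2l // lerBlDr -natrM -natrD ler_nat; lia.
have hes : h * e <= s by exact: leq_trunc_div.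
have kh : k * (h * e) <= n by rewrite (leq_trans _ ksn) // leq_mul2l hes orbT.
have b1 : (4 * (lam * d%:R) <= rho * n%:R)%R.
  rewrite mulrA (le_trans (ler_wpM2r _ hg)) // -mulrA ler_pM2l // -natrM ler_nat //.
have b2 : (800 * (k * h)%:R <= rho * n%:R)%R.
  rewrite (le_trans (ler_wpM2r _ he)) // -mulrA ler_pM2l // -natrM ler_nat.
  by rewrite mulnC -mulnA.
have b3 : (12 * s%:R <= rho * n%:R)%R.
  by rewrite (le_trans (ler_wpM2r _ hk)) // -mulrA ler_pM2l // -natrM ler_nat.
have b4 : ((2 * M)%:R * h%:R <= (k * h)%:R :> R)%R by rewrite -natrM ler_nat leq_mul2r Mk orbT.
have b5 : (lam * (k * s)%:R - 3 * s%:R <= (2 * M)%:R * s%:R)%R.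
  rewrite natrM mulrA -mulrBl ler_wpM2r // lerBlDr; move: hM; rewrite natrD; exact: ltW.
have b6 : (n%:R = d%:R + (k * s)%:R :> R)%R by rewrite {1}nE natrD.
have b7 : (lam * n%:R = lam * d%:R + lam * (k * s)%:R)%R by rewrite b6 mulrDr.
have b8 : (0 <= rho * n%:R)%R by rewrite mulr_ge0 // ltW.
apply: le_trans lower; lra.
Qed.

(** * Monochromatic cycles in spread graphs *)

Definition spread (N n : nat) (G : sgraph 'I_n) : Prop :=
  forall X Y : {set 'I_n}, [disjoint X & Y] -> n <= N * #|X| -> n <= N * #|Y| ->
    exists x y, [/\ x \in X, y \in Y & [set x; y] \in edges G].

Lemma spread_mono_cycles (R : realType) r (lam rho : R) :
  0 < r -> @lambda_odd_set R r lam -> (0 < rho)%R ->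
  exists N, forall n (G : sgraph 'I_n), N <= n -> spread N G ->
    forall c : {set 'I_n} -> 'I_r, exists i : 'I_r, forall t, odd t ->
      4 * trunc_log 2 n <= t -> (t%:R <= (lam - rho) * n%:R)%R ->
      mono_copy G c i (cycle_graph t).
Proof.
move=> r0 [lam0 [eps [eps0 [k0 Hk0]]]] rho0.
pose natabove (x : R) := (Num.truncn x).+1.
have natP x : (x <= (natabove x)%:R)%R by rewrite ltW // truncnS_gt.
(* [g], [e] and [12 / rho] feed [length_budget]; [e'] makes the reduced graph dense enough for
   [eps]; [5 / lam] makes its odd cycle longer than 2; [e >= 200] gives [200 * h <= s]. *)
pose g := (natabove (4 * lam / rho)%R).+1; pose e := maxn 200 (natabove (800 / rho)%R).
pose e' := natabove (1 / eps)%R.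
pose kmin := k0 + natabove (12 / rho)%R + natabove (5 / lam)%R.
have g4 : (4 * lam <= rho * g%:R)%R.
  by rewrite -ler_pdivrMl // mulrC (le_trans (natP _)) // ler_nat; exact: leqnSn.
have e8 : (800 <= rho * e%:R)%R.
  by rewrite -ler_pdivrMl // mulrC (le_trans (natP _)) // ler_nat; exact: leq_maxr.
have e200 : 200 <= e by exact: leq_maxl.
have e0 : 0 < e by exact: leq_trans e200.
have e'eps : (1 <= eps * e'%:R)%R by rewrite -ler_pdivrMl // mulrC natP.
have [N0 HN0] := @regular_pieces_exist r kmin g e e' r0 isT e0 isT.
(* The power of 2 gives [trunc_log 2 n >= N0 + 4], so that [4 * trunc_log 2 n] exceeds
   [2 * D + 2 * M + 3]; [N0 * e] gives [s >= e], hence [h > 0]. *)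
exists (2 ^ (N0 + 4) + N0 * e) => n G Nn spG c.
pose E := color_rel G c.
have N0n : N0 <= n.
  by rewrite (leq_trans _ Nn) // (leq_trans _ (leq_addl _ _)) // leq_pmulr.
have [||k [s [V []]]] := HN0 'I_n E; rewrite ?card_ord //.
  move=> X Y dXY; rewrite card_ord => hX hY.
  have N0N : N0 <= 2 ^ (N0 + 4) + N0 * e.
    by rewrite (leq_trans _ (leq_addl _ _)) // leq_pmulr.
  have [||x [y [xX yY Exy]]] := spG X Y dXY.
  - by rewrite (leq_trans hX) // leq_mul2r N0N orbT.
  - by rewrite (leq_trans hY) // leq_mul2r N0N orbT.
  by exists (c [set x; y]), x, y; split=> //; apply/andP.
move=> /andP[kk kN0] sN0 [ksn gks] [cV dV] badc.
set h := s %/ e in badc.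
have symE a : symmetric (E a) by exact: color_rel_sym.
have [col colP] := @reduced_coloring r _ E k h V symE (Ordinal r0).
have klam : (5 <= lam * k%:R)%R.
  rewrite -ler_pdivrMl // mulrC (le_trans (natP _)) // ler_nat.
  by rewrite (leq_trans _ kk) // leq_addl.
have krho : (12 <= rho * k%:R)%R.
  rewrite -ler_pdivrMl // mulrC (le_trans (natP _)) // ler_nat.
  by rewrite (leq_trans _ kk) // /kmin -addnA addnCA leq_addr.
have kk0 : k0 <= k by rewrite (leq_trans _ kk) // /kmin -addnA leq_addr.
have k0' : 0 < k by rewrite (leq_trans _ kk) // /kmin addnS.
have [|i [f [finj fP]]] := Hk0 k kk0 (reduced_graph E h V) _ col.
  have := card_reduced E h V; rewrite -(ler_nat R) natrD => cr.
  have : (e'%:R * #|bad_pairs E V h|%:R <= 'C(k, 2)%:R :> R)%R by rewrite -natrM ler_nat.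
  set b := (#|bad_pairs E V h|%:R)%R in cr *; set C := ('C(k, 2)%:R)%R in cr * => eb.
  have : (b <= eps * C)%R.
    rewrite (le_trans _ (ler_wpM2l (ltW eps0) eb)) // mulrA -{1}[b]mul1r ler_wpM2r //.
  lra.
set m := oddfloor _ in f finj fP.
have lam1 : (1 <= lam * k%:R)%R by apply: le_trans klam; rewrite ler1n.
have [modd mlam _] := oddfloorP lam1.
have mlow := oddfloor_lower lam1; rewrite -/m in modd mlam mlow.
have mM : m = 2 * m./2 + 1 by rewrite -[LHS]odd_double_half modd mul2n addnC.
set M := m./2 in mM.
have m2 : 2 < m.
  rewrite -(ltr_nat R); move: mlow klam; rewrite -addn2 natrD; clear; lra.
have M0 : 0 < M by rewrite half_gt0 ltnW.
have mk : m <= k by have := leq_card f finj; rewrite !card_ord.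
pose V' a := if insub a is Some j then V (f j) else finset.set0 : {set 'I_n}.
have V'E (j : 'I_m) : V' j = V (f j) by rewrite /V' valK.
have joinf (j : 'I_m) : joined (E i) h (V (f j)) (V (f (ordS j))).
  have neq : ordS j != j.
    apply/eqP => /(congr1 val) /=; have := ltn_ord j; rewrite leq_eqVlt.
    case/predU1P => [jm|jm]; last by rewrite modn_small // => /esym/n_Sn.
    by rewrite jm modnn => j0; move: m2; rewrite -jm -j0.
  have [|] := fP [set j; ordS j].
    by apply/imsetP; exists j; rewrite ?inE.
  by rewrite imsetU1 imset_set1 => /colP + ci; rewrite ci.
have s_large : e <= s.
  rewrite -(@leq_pmul2l N0) ?(leq_trans k0' kN0) // (leq_trans _ sN0) //.
  by rewrite (leq_trans _ Nn) // leq_addl.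
have h0 : 0 < h by rewrite divn_gt0.
have h200 : 200 * h <= s.
  by rewrite (leq_trans _ (leq_trunc_div s e)) // mulnC leq_mul2l e200 orbT.
have V'lt a : a < 2 * M + 1 -> exists2 j : 'I_m, a = j & V' a = V (f j).
  by rewrite -mM => am; exists (Ordinal am) => //; rewrite -V'E.
have disV' a b x : a < 2 * M + 1 -> b < 2 * M + 1 -> x \in V' a -> x \in V' b -> a = b.
  move=> /V'lt[ja -> ->] /V'lt[jb -> ->] xa xb.
  by rewrite (finj _ _ (dV _ _ _ xa xb)).
have cardV' a : a < 2 * M + 1 -> #|V' a| = s by move=> /V'lt[ja _ ->].
have joinV' a : a < 2 * M -> joined (E i) h (V' a) (V' a.+1).
  move=> aM; have [|j aj ->] := @V'lt a; first by rewrite addn1 ltnW.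
  have [|j' aj' ->] := @V'lt a.+1; first by rewrite addn1.
  have -> : j' = ordS j; last exact: joinf.
  apply: val_inj; rewrite /= -aj modn_small -?aj' //.
  by rewrite mM addn1.
have joinV0' : joined (E i) h (V' (2 * M)) (V' 0).
  have [|j aj ->] := @V'lt (2 * M); first by rewrite addn1.
  have [|j' aj' ->] := @V'lt 0; first by rewrite addn1.
  have -> : j' = ordS j; last exact: joinf.
  by apply: val_inj; rewrite /= -aj -aj' -addn1 -mM modnn.
have [D Ds cyc] := blowup_cycle (symE i) M0 h0 h200 disV' cardV' joinV' joinV0'.
(* The color [i], [M] and [D] are fixed before [t], so one color serves all lengths. *)
exists i => t todd tlow tup.
have sn : s <= n by rewrite (leq_trans _ ksn) // leq_pmull.
have n0 : 0 < n by apply: leq_trans Nn; rewrite ltn_addr // expn_gt0.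
have Dl : D <= trunc_log 2 n by apply: trunc_log_max => //; exact: leq_trans sn.
have N0l : N0 + 4 <= trunc_log 2 n.
  by apply: trunc_log_max => //; rewrite (leq_trans _ Nn) // leq_addr.
have Mk : 2 * M <= k by rewrite (leq_trans _ mk) // mM leq_addr.
have tbudget : t <= 2 * (M * (s - 200 * h)).
  apply: (length_budget (ltW lam0) rho0 g4 e8 krho _ tup ksn gks Mk isT).
  by rewrite (lt_le_trans mlow) // ler_nat mM -addnS -addnS.
have tlow2 : 2 * D + 2 * M + 3 <= t by clear -tlow Dl N0l Mk kN0; lia.
have [Q tQ] : exists Q, t = 2 * D + 2 * Q + 3.
  exists (t - 2 * D - 3)./2; clear -tlow2 todd; lia.
have [|s' [us ss cs]] := cyc Q; last by apply: mono_cycle us _ cs; rewrite tQ.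
clear -tQ tlow2 tbudget; lia.
Qed.

End ColoredGraphs.

(** * The random graph *)

Section BinomialRandomGraph.
Set Implicit Arguments.
Unset Strict Implicit.
Unset Printing Implicit Defensive.
Local Open Scope bool_scope.
Local Open Scope ring_scope.
Local Open Scope set_scope.
Variables (R : realType) (n : nat) (p : R).
Hypothesis p01 : 0 <= p <= 1.

Lemma gnp_weight_ge0 (G : sgraph 'I_n) : 0 <= gnp_weight p G.
Proof.
case/andP: p01 => p0 p1; apply: prodr_ge0 => e _.
by case: ifP => // _; rewrite subr_ge0.
Qed.

(** The power is a product over all sets [e] of [a e + b e], with [a] for present and [b] for
    absent. Expanding it over sets [J], those containing a non-pair or meeting [S] vanish, and the
    others contribute the weights of the graphs avoiding [S]. *)
Lemma gnp_prob_no_edge (S : {set {set 'I_n}}) : S \subset pairs 'I_n ->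
  gnp_prob p (fun G => [disjoint edges G & S]) = (1 - p) ^+ #|S|.
Proof.
move=> SP; pose a e := if e \in pairs 'I_n :\: S then p else 0 : R.
pose b e := if e \in pairs 'I_n then 1 - p else 1 : R.
transitivity (\prod_e (a e + b e)); last first.
  rewrite (bigID (mem S)) /= [X in _ * X]big1 ?mulr1 => [|e eS].
    rewrite -prodr_const; apply: eq_bigr => e eS.
    by rewrite /a /b inE eS (fintype.subsetP SP) // add0r.
  by rewrite /a /b inE (negbTE eS) /=; case: ifP => _; rewrite ?add0r // addrC subrK.
rewrite bigA_distr /= (bigID [pred J : {set {set 'I_n}} | J \subset pairs 'I_n]) /=.
rewrite [X in _ + X]big1 ?addr0 => [|J /fintype.subsetPn[e eJ eP]]; last first.
  by rewrite (bigD1 e) //= eJ /a inE (negbTE eP) andbF mul0r.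
rewrite (reindex_omap (val : sgraph 'I_n -> _) insub) => [|J JP]; last first.
  by rewrite insubT.
rewrite [RHS](eq_bigl xpredT) => [|G]; last by rewrite (valP G) valK eqxx.
rewrite /gnp_prob [RHS](bigID (fun G : sgraph 'I_n => [disjoint edges G & S])) /=.
rewrite [X in _ = _ + X]big1 ?addr0 => [|G]; last first.
  rewrite disjoint_subset => /fintype.subsetPn[e eG eS].
  rewrite !inE negbK in eS.
  by rewrite (bigD1 e) //= -/(edges G) eG /a inE eS mul0r.
apply: eq_big => [G|G]; first by rewrite asboolb.
rewrite asboolb => dis; rewrite /gnp_weight big_mkcond /=.
apply: eq_bigr => e _; rewrite -/(edges G) /a /b !inE.
case: ifP => eP; case: ifP => eG //.
  by rewrite (disjointFr dis eG).
by have := fintype.subsetP (valP G) e eG; rewrite inE eP.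
Qed.

Lemma gnp_prob_total : gnp_prob p (fun _ : sgraph 'I_n => True) = 1.
Proof.
rewrite -(expr0 (1 - p)) -(cards0 {set 'I_n}) -gnp_prob_no_edge ?finset.sub0set //.
apply: eq_bigl => G; congr asbool; apply/propext; split=> // _.
by rewrite disjoint_sym -finset.setI_eq0 finset.set0I.
Qed.

Lemma gnp_prob_mono (Q Q' : sgraph 'I_n -> Prop) : (forall G, Q G -> Q' G) ->
  gnp_prob p Q <= gnp_prob p Q'.
Proof.
move=> QQ'; rewrite /gnp_prob [leRHS](bigID (fun G => `[< Q G >])) /=.
rewrite [leLHS](eq_bigl (fun G => `[< Q' G >] && `[< Q G >])) => [|G].
  by rewrite lerDl sumr_ge0 // => G _; exact: gnp_weight_ge0.
by apply/idP/andP => [/asboolP q|[]//]; split; apply/asboolP => //; exact: QQ'.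
Qed.

Lemma gnp_prob_le1 (Q : sgraph 'I_n -> Prop) : gnp_prob p Q <= 1.
Proof. by rewrite -gnp_prob_total; exact: gnp_prob_mono. Qed.

Lemma gnp_prob_union (I : finType) (Q : sgraph 'I_n -> Prop)
    (B : I -> sgraph 'I_n -> Prop) :
  (forall G, ~ Q G -> exists x, B x G) -> 1 - \sum_x gnp_prob p (B x) <= gnp_prob p Q.
Proof.
move=> cover; rewrite lerBlDr -gnp_prob_total /gnp_prob.
rewrite (exchange_big_dep xpredT) //= [X in _ <= X + _]big_mkcond -big_split /=.
rewrite big_mkcond ler_sum // => G _; rewrite asboolT //.
have w0 := gnp_weight_ge0 G.
case: asboolP => [_|/cover[x BxG]]; first by rewrite lerDl sumr_ge0.
rewrite add0r (bigD1 x) ?lerDl ?sumr_ge0 //.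
by apply/asboolP.
Qed.
End BinomialRandomGraph.

(** * Union bound over pairs of linear-size sets *)

Section Spread.
Set Implicit Arguments.
Unset Strict Implicit.
Unset Printing Implicit Defensive.
Local Open Scope bool_scope.
Local Open Scope ring_scope.
Local Open Scope set_scope.
Lemma card_cross (T : finType) (X Y : {set T}) : [disjoint X & Y] ->
  #|[set [set z.1; z.2] | z in finset.setX X Y]| = (#|X| * #|Y|)%N.
Proof.
move=> dis; rewrite card_in_imset ?cardsX // => -[x y] [x' y'].
rewrite !finset.in_setX => /andP[xX yY] /andP[x'X y'Y] /= e.
have : x \in [set x'; y'] by rewrite -e !inE eqxx.
have : y \in [set x'; y'] by rewrite -e !inE eqxx orbT.
rewrite !inE => /orP[/eqP yx'|/eqP->] /orP[/eqP->|/eqP xy'] //.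
- by rewrite yx' (disjointFr dis x'X) in yY.
- by rewrite yx' (disjointFr dis x'X) in yY.
- by rewrite -xy' (disjointFr dis xX) in y'Y.
Qed.

Variable (R : realType).

(* Union bound: at most [4 ^ n] pairs [X, Y], each without an edge with
   probability at most [exp (- p * #|X| * #|Y|) <= exp (- 3 * n)]. *)
Lemma gnp_spread (N n : nat) (p : R) : (0 < n)%N -> (0 < N)%N -> 0 <= p <= 1 ->
  3 * N%:R ^+ 2 / n%:R <= p -> 1 - n.+1%:R^-1 <= gnp_prob p (@spread N n).
Proof.
move=> n0 N0 p01 pC.
pose big (X Y : {set 'I_n}) := [&& [disjoint X & Y], (n <= N * #|X|)%N & (n <= N * #|Y|)%N].
pose cross (X Y : {set 'I_n}) := [set [set z.1; z.2] | z in finset.setX X Y].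
pose B (z : {set 'I_n} * {set 'I_n}) (G : sgraph 'I_n) :=
  big z.1 z.2 /\ [disjoint edges G & cross z.1 z.2].
apply: le_trans (gnp_prob_union (B := B) p01 _); last first.
  move=> G /existsNP[X /existsNP[Y /not_implyP[dis /not_implyP[hX /not_implyP[hY nE]]]]].
  exists (X, Y); split; first exact/and3P.
  rewrite disjoint_sym disjoint_subset; apply/fintype.subsetP => e /imsetP[[x y]].
  rewrite finset.in_setX => /andP[xX yY] ->; rewrite inE; apply/negP => eE.
  by apply: nE; exists x, y.
rewrite lerD2l lerN2.
have bound z : gnp_prob p (B z) <= expR (- (3 * n%:R)).
  case: z => X Y; have [bXY|nXY] := boolP (big X Y); last first.
    rewrite /gnp_prob big_pred0 ?expR_ge0 // => G.
    by apply/asboolP => -[]; rewrite (negbTE nXY).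
  have /and3P[dis hX hY] := bXY.
  have subP : cross X Y \subset pairs 'I_n.
    apply/fintype.subsetP => e /imsetP[[x y]]; rewrite finset.in_setX => /andP[xX yY] ->.
    rewrite /pairs inE cards2; case: (x =P y) => // xy.
    by rewrite xy (disjointFl dis yY) in xX.
  apply: le_trans (_ : gnp_prob p (fun G : sgraph 'I_n => [disjoint edges G & cross X Y]) <= _).
    by apply: gnp_prob_mono => // G [].
  rewrite gnp_prob_no_edge // card_cross //.
  case/andP: (p01) => p0 p1.
  apply: le_trans (_ : expR (- p) ^+ (#|X| * #|Y|) <= _).
    by rewrite lerXn2r ?nnegrE ?expR_ge0 ?subr_ge0 // expR_ge1Dx.
  rewrite -expRM_natr ler_expR mulNr lerN2.
  have n0' : 0 < n%:R :> R by rewrite ltr0n.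
  have N0' : 0 < N%:R :> R by rewrite ltr0n.
  have nXY : n%:R * n%:R <= N%:R ^+ 2 * (#|X| * #|Y|)%:R :> R.
    rewrite -natrX -!natrM ler_nat -mulnn mulnACA; exact: leq_mul.
  apply: le_trans (_ : 3 * N%:R ^+ 2 / n%:R * (#|X| * #|Y|)%:R <= _); last exact: ler_wpM2r.
  by rewrite mulrAC ler_pdivlMr // -!mulrA ler_pM2l // [leRHS]mulrA -expr2.
apply: le_trans (ler_sum _ (fun z _ => bound z)) _.
rewrite sumr_const card_prod -cardsT -powersetT card_powerset cardsT card_ord.
(* The number of pairs is at most [expR (2 * n)], as [expR 1 >= 2]; this leaves [expR (- n)], at
   most [1 / (n + 1)]. *)
have e4 : (2 ^ n * 2 ^ n)%:R <= expR (2 * n%:R) :> R.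
  rewrite natrM natrX -exprMn expRM_natr lerXn2r ?nnegrE ?expR_ge0 ?mulr_ge0 //.
  have -> : expR 2 = expR 1 * expR 1 :> R by rewrite -expRD.
  by apply: ler_pM => //; apply: le_trans (expR_ge1Dx _).
rewrite -[leLHS]mulr_natr (le_trans (ler_wpM2l (expR_ge0 _) e4)) // -expRD.
have -> : - (3 * n%:R) + 2 * n%:R = - n%:R :> R by lra.
rewrite expRN lef_pV2 ?posrE ?expR_gt0 // (le_trans _ (expR_ge1Dx _)) //.
by rewrite -natr1 addrC.
Qed.

Lemma gnp_whp_spread (N : nat) (p : nat -> R) (Q : forall n, sgraph 'I_n -> Prop) :
  (0 < N)%N -> (forall n, 0 <= p n <= 1) ->
  (\forall n \near \oo, 3 * N%:R ^+ 2 / n%:R <= p n) ->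
  (\forall n \near \oo, forall G : sgraph 'I_n, spread N G -> Q n G) -> gnp_whp p Q.
Proof.
move=> N0 p01 pC sQ.
apply: (@squeeze_cvgr _ _ _ _ (fun n => 1 - n.+1%:R^-1) (fun=> 1)).
- near=> n; apply/andP; split; last exact: gnp_prob_le1.
  apply: le_trans (gnp_spread _ N0 (p01 n) _) _.
  + by near: n; exact: nbhs_infty_gt.
  + by near: n.
  by apply: gnp_prob_mono => //; near: n.
- rewrite -[X in _ --> X]subr0; apply: cvgB; first exact: cvg_cst.
  exact: cvg_harmonic.
- exact: cvg_cst.
Unshelve. all: by end_near. Qed.

(** * Comparing logarithmic and linear lengths *)

Lemma log_budget (n t : nat) : (0 < n)%N -> 4 / ln 2 * ln n%:R <= t%:R :> R ->
  (4 * trunc_log 2 n <= t)%N.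
Proof.
move=> n0 ht; rewrite -(ler_nat R); apply: le_trans ht; rewrite natrM.
have ln2 : 0 < ln 2 :> R by rewrite ln_gt0 // ltr1n.
rewrite -mulrA ler_pM2l // mulrC ler_pdivlMr //.
have : ((2 ^ trunc_log 2 n)%:R <= n%:R :> R) by rewrite ler_nat trunc_logP.
by rewrite -ler_ln ?posrE ?ltr0n ?expn_gt0 // natrX lnXn // mulr_natl.
Qed.

(** Applying [ln y <= y] to [y = eps * x] bounds [A * ln x] by [c / 2 * x] plus a constant; the
    other half of [c * n] absorbs the constants. *)
Lemma ln_le_linear (A c b : R) : 0 < A -> 0 < c ->
  \forall n \near \oo, A * ln n%:R + b <= c * n%:R.
Proof.
move=> A0 c0; pose eps := c / (2 * A).
have eps0 : 0 < eps by rewrite divr_gt0 // mulr_gt0.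
have key x : 0 < x -> A * ln x <= c / 2 * x - A * ln eps.
  move=> x0; have : ln (eps * x) <= eps * x by rewrite ltW // ln_sublinear // mulr_gt0.
  rewrite lnM ?posrE // -(ler_pM2l A0) mulrDr lerBrDl => /le_trans; apply.
  suff -> : A * (eps * x) = c / 2 * x by [].
  by rewrite /eps; field; rewrite lt0r_neq0.
near=> n; have n0 : 0 < n%:R :> R by rewrite ltr0n; near: n; exact: nbhs_infty_gt.
rewrite (le_trans (lerD (key _ n0) (lexx b))) //.
have : (b - A * ln eps) * 2 / c <= n%:R by near: n; exact: nbhs_infty_ger.
rewrite ler_pdivrMr //; lra.
Unshelve. all: by end_near. Qed.
End Spread.

(** * Approximating the supremum and passing to the random graph *)

Theorem theorem7p7 (R : realType) (r : nat) (hr : (1 < r)%N) :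
  exists A : R, 0 < A /\
  forall beta : R, 0 < beta ->
  exists C : R, 0 < C /\
  forall p : nat -> R,
    (forall n : nat, 0 <= p n <= 1) ->
    (\forall n \near \oo, C / n%:R <= p n) ->
    gnp_whp p (fun (n : nat) (G : sgraph 'I_n) =>
      arrows_family r G
        [set t : nat | A * ln n%:R <= t%:R <= (lambda_odd R r - beta) * n%:R
                       /\ odd t]
        cycle_graph)
    /\
    (beta < lambda_odd R r ->
     gnp_whp p (fun (n : nat) (G : sgraph 'I_n) =>
       arrows r G (cycle_graph (oddfloor ((lambda_odd R r - beta) * n%:R))))).
Proof.
have r0 : (0 < r)%N by exact: ltnW.
have ln2 : 0 < ln 2 :> R by rewrite ln_gt0 // ltr1n.
(* With this value [A * ln n] is four times the binary logarithm, as [log_budget] requires. *)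
exists (4 / ln 2); split; first by rewrite divr_gt0.
move=> beta beta0; have [lam_small|lam_big] := leP (lambda_odd R r) beta.
  (* No length qualifies once [n > 1]: the upper end is at most 0 and the lower end positive. The
     constant has the shape needed for [gnp_whp_spread] with [N = 1]. *)
  exists (3 * 1 ^+ 2); split; first by rewrite expr1n mulr1.
  move=> p p01 pC; split=> [|//].
  apply: (@gnp_whp_spread _ 1) => //.
  near=> n => G _ c; exists (Ordinal r0) => t [/andP[tlow tup] _].
  have n1 : (1 < n)%N by near: n; exact: nbhs_infty_gt.
  have := le_trans tlow tup; rewrite leNgt => /negP[].
  apply: (@le_lt_trans _ _ 0); first by rewrite mulr_le0_ge0 // subr_le0.
  by rewrite mulr_gt0 ?divr_gt0 ?ln_gt0 // ltr1n.
(* Without a supremum, [sup] would take its default value 0, contrary to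
   [0 < beta < lambda_odd R r]. *)
have has : has_sup (@lambda_odd_set R r).
  apply: contrapT => nhas; move: lam_big; rewrite /lambda_odd sup_out //.
  by rewrite ltNge ltW.
(* Half of [beta] is spent on approaching the supremum by [lam], the other half is [rho]. *)
have [lam Hlam ltlam] := sup_adherent (divr_gt0 beta0 (ltr0n R 2)) has.
rewrite -/(lambda_odd R r) in ltlam.
have [N HN] := spread_mono_cycles r0 Hlam (divr_gt0 beta0 (ltr0n R 2)).
exists (3 * N.+1%:R ^+ 2); split; first by rewrite mulr_gt0 // exprn_gt0.
move=> p p01 pC.
have family n (G : sgraph 'I_n) : (N < n)%N -> spread N.+1 G ->
    arrows_family r G [set t : nat | (4 / ln 2 : R) * ln n%:R <= t%:R <=
      (lambda_odd R r - beta) * n%:R /\ odd t] cycle_graph.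
  move=> Nn sG c; have [|i Hi] := HN n G (ltnW Nn) _ c.
    move=> X Y dis hX hY; apply: sG => //.
      by rewrite (leq_trans hX) // leq_mul2r leqnSn orbT.
    by rewrite (leq_trans hY) // leq_mul2r leqnSn orbT.
  exists i => t [/andP[tlow tup] todd]; apply: Hi => //.
    by apply: log_budget tlow; apply: leq_ltn_trans Nn.
  rewrite (le_trans tup) // ler_wpM2r //; lra.
have large : \forall n \near \oo, (N < n)%N by exact: nbhs_infty_gt.
split=> [|_]; apply: (@gnp_whp_spread _ N.+1) => //.
  by near=> n => G; apply: family; near: n.
have c0 : 0 < lambda_odd R r - beta by rewrite subr_gt0.
have A0 : 0 < 4 / ln 2 :> R by rewrite divr_gt0.
near=> n => G sG c; have [|i Hi] := family n G _ sG c; first by near: n.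
exists i; apply: Hi; set x := _ * n%:R.
(* The odd floor exceeds [x - 2], so the extra 2 keeps it above the logarithmic lower end of the
   family. *)
have Ax : 4 / ln 2 * ln n%:R + 2 <= x by rewrite /x; near: n; exact: ln_le_linear.
have n0 : (0 < n)%N by near: n; exact: nbhs_infty_gt.
have x1 : 1 <= x.
  have : 0 <= 4 / ln 2 * ln n%:R :> R by apply: mulr_ge0 (ltW A0) _; rewrite ln_ge0 // ler1n.
  lra.
have [todd tx _] := oddfloorP x1; split=> //; rewrite tx andbT.
have := oddfloor_lower x1; rewrite -addn2 natrD; lra.
Unshelve. all: by end_near. Qed.
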